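(* Let $I=\langle T_0^{d_1},T_0^{u_1}T_1^{u_2},T_1^{d_2}\rangle\subset\mathbb{K}[T_0,T_1]$ with $0<u_1<d_1$, $0<u_2<d_2$, let $\mathcal{R}(I)\subset S=\mathbb{K}[T_0,T_1,X_0,X_1,X_2]$ be its Rees ideal, let $g_1,\dots,g_r$ be the sorted list of minimal generators of $\mathcal{R}(I)$ and let $\Gamma=\mathrm{Graph}(\mathcal{R}(I))$ be the Rees graph of $I$ (all defined in the context). Then the minimal free resolution of $\mathcal{R}(I)$ over $S$ has the form $$0\longrightarrow S^{r-3}\xrightarrow{\ \phi_2\ }S^{2(r-2)}\xrightarrow{\ \phi_1\ }S^{r}\xrightarrow{\ \phi_0\ }\mathcal{R}(I)\longrightarrow 0$$ and is encoded in $\Gamma$ as follows: $S^r$ has basis $\{\mathbf{e}_1,\dots,\mathbf{e}_r\}$ indexed by the nodes of $\Gamma$, $S^{2(r-2)}$ has basis $\{\mathbf{f}_{(j,k)}\}$ indexed by the directed edges $(j\to k)$ of $\Gamma$, $S^{r-3}$ has basis $\{\mathbf{t}_{(j,k,\ell)}\}$ indexed by the triangles $(j,k,\ell)$ of $\Gamma$, and $$\phi_0(\mathbf{e}_j)=g_j,\qquad \phi_1(\mathbf{f}_{(j,k)})=v(j,k)\,\mathbf{e}_j-v(k,j)\,\mathbf{e}_k+w(j,k)\,\mathbf{e}_h,$$ where $h\neq j$ is the source of the other edge $(h\to k)$ of $\Gamma$ with target $k$, and $$\phi_2(\mathbf{t}_{(j,k,\ell)})=v(h,k)\,\mathbf{f}_{(j,k)}-v(\ell,k)\,\mathbf{f}_{(j,\ell)}+v(\ell,j)\,\mathbf{f}_{(k,\ell)}-w(j,k)\,\mathbf{f}_{(h,k)},$$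 where $h\ne j$ is the source of the other edge $(h\to k)$ of $\Gamma$ with target $k$.
   Context: Setting. $\mathbb{K}$ is a field; $d_1,d_2,u_1,u_2$ are integers with $0<u_1<d_1$, $0<u_2<d_2$; $S=\mathbb{K}[T_0,T_1,X_0,X_1,X_2]$. The Rees ideal $\mathcal{R}(I)$ is the kernel of the $\mathbb{K}[T_0,T_1]$-algebra map $\phi:S\to\mathbb{K}[T_0,T_1][z]$, $X_0\mapsto T_0^{d_1}z$, $X_1\mapsto T_0^{u_1}T_1^{u_2}z$, $X_2\mapsto T_1^{d_2}z$. Sequences. For $k\in\{1,2\}$ and $j\ge1$: $a^{(k)}_j=u_kj \bmod d_k\in\{0,\dots,d_k-1\}$, $b^{(k)}_j=\lfloor u_kj/d_k\rfloor$. Sorted minimal generators $g_1,\dots,g_r$ (output of the paper's algorithm, each written as leading term minus tail term). Start with $g_1=T_0^{d_1-u_1}X_1-T_1^{u_2}X_0$ (an upper generator) and $g_2=T_1^{d_2-u_2}X_1-T_0^{u_1}X_2$ (a lower generator), and set $\max^{(k)}=\min^{(k)}=u_k$ for $k=1,2$. For $j=2,3,\dots$, in order: (i) if $b^{(1)}_j-b^{(1)}_{j-1}=b^{(2)}_j-b^{(2)}_{j-1}=0$, append the upper generator $T_0^{d_1-a^{(1)}_j}T_1^{d_2-a^{(2)}_j}X_1^j-X_0^{b^{(1)}_j+1}X_2^{b^{(2)}_j+1}$ and stop; (ii) if $b^{(1)}_j-b^{(1)}_{j-1}=b^{(2)}_j-b^{(2)}_{j-1}=1$, append the lower generator $X_1^j-T_0^{a^{(1)}_j}T_1^{a^{(2)}_j}X_0^{b^{(1)}_j}X_2^{b^{(2)}_j}$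 and stop; (iii) otherwise, if $a^{(1)}_j>\max^{(1)}$ and $a^{(2)}_j<\min^{(2)}$, append the upper generator $T_0^{d_1-a^{(1)}_j}X_1^j-T_1^{a^{(2)}_j}X_0^{b^{(1)}_j+1}X_2^{b^{(2)}_j}$ and set $\max^{(1)}=a^{(1)}_j$, $\min^{(2)}=a^{(2)}_j$; if $a^{(1)}_j<\min^{(1)}$ and $a^{(2)}_j>\max^{(2)}$, append the lower generator $T_1^{d_2-a^{(2)}_j}X_1^j-T_0^{a^{(1)}_j}X_0^{b^{(1)}_j}X_2^{b^{(2)}_j+1}$ and set $\min^{(1)}=a^{(1)}_j$, $\max^{(2)}=a^{(2)}_j$; then stop if $a^{(1)}_j=0$ or $a^{(2)}_j=0$. The set $\{g_1,\dots,g_r\}$ is the minimal generating set of $\mathcal{R}(I)$. Notation. In each $g_j$ above the first monomial is denoted $\mathrm{lt}(g_j)$ and the second (without sign) $\mathrm{tt}(g_j)$, so $g_j=\mathrm{lt}(g_j)-\mathrm{tt}(g_j)$. Put $v(a,b)=\mathrm{lcm}(\mathrm{lt}(g_a),\mathrm{lt}(g_b))/\mathrm{lt}(g_a)$ and $w(a,b)=\gcd(\mathrm{tt}(g_a),\mathrm{tt}(g_b))$. Rees graph. $\Gamma=\mathrm{Graph}(\mathcal{R}(I))$ is the directed graph with nodes $g_1,\dots,g_r$ (also written $1,\dots,r$) arranged in a top row (upper generators) and a bottom row (lower generators). Start with $g_1$ in the top row and $g_2$ in the bottom row, no edge between them. For $i=3,\dots,r$ in order: draw an edge to $g_i$ from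 the current rightmost node of the top row and from the current rightmost node of the bottom row, then place $g_i$ as the new rightmost node of the top row if it is upper and of the bottom row if it is lower. $\Gamma$ has $r$ nodes, $2(r-2)$ edges and $r-3$ triangles. A triangle $(j,k,\ell)$ of $\Gamma$ consists of three nodes with edges $j\to k$, $j\to\ell$, $k\to\ell$. Minimality refers to the natural multigrading of $S$ making $\mathcal{R}(I)$ homogeneous (equivalently, all entries of the matrices of $\phi_1,\phi_2$ lie in $\langle T_0,T_1,X_0,X_1,X_2\rangle$). *)

(* Defs.v *)
From HB Require Import structures.
From mathcomp Require Import all_boot all_order all_algebra.
From mathcomp Require Import zify.
From mathcomp.multinomials Require Import mpoly.
Set Implicit Arguments.
Unset Strict Implicit.
Unset Printing Implicit Defensive.
Import GRing.Theory.
Local Open Scope ring_scope.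

(* S = K[T0, T1, X0, X1, X2] is {mpoly K[5]}, with the variables numbered in
   this order; the monomial T0^t0 T1^t1 X0^x0 X1^x1 X2^x2 is: *)
Definition mon (t0 t1 x0 x1 x2 : nat) : 'X_{1..5} :=
  [multinom [tuple t0; t1; x0; x1; x2]].

(* K[T0, T1][z] is {mpoly K[3]}, with the variables T0, T1, z in this order. *)
Definition rees_map (K : fieldType) (d1 d2 u1 u2 : nat) (p : {mpoly K[5]}) :
    {mpoly K[3]} :=
  let T0 : {mpoly K[3]} := 'X_(inord 0) in
  let T1 : {mpoly K[3]} := 'X_(inord 1) in
  let z : {mpoly K[3]} := 'X_(inord 2) in
  p \mPo [tuple T0; T1;
                T0 ^+ d1 * z; T0 ^+ u1 * T1 ^+ u2 * z; T1 ^+ d2 * z].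

Definition rees_ideal (K : fieldType) (d1 d2 u1 u2 : nat) :
    pred {mpoly K[5]} :=
  [pred p | rees_map d1 d2 u1 u2 p == 0].

(* The Z^3-multidegree of a monomial of S for which rees_map is homogeneous:
   the exponent vector in (T0, T1, z) of its image. *)
Definition rees_deg (d1 d2 u1 u2 : nat) (m : 'X_{1..5}) : 'X_{1..3} :=
  let e i := m (inord i) in
  [multinom [tuple (e 0 + d1 * e 2 + u1 * e 3)%N;
                   (e 1 + u2 * e 3 + d2 * e 4)%N;
                   (e 2 + e 3 + e 4)%N]].

(* A generator lead - tail, upper or lower. *)
Record rees_gen := ReesGen {
  is_upper : bool;
  lead : 'X_{1..5};
  tail : 'X_{1..5}
}.

Definition gen_poly (K : fieldType) (x : rees_gen) : {mpoly K[5]} :=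
  'X_[lead x] - 'X_[tail x].

(* Steps j, j+1, ..., at most fuel of them. *)
Fixpoint rees_loop (d1 d2 u1 u2 fuel j max1 min1 max2 min2 : nat) :
    seq rees_gen :=
  if fuel is fuel'.+1 then
    let a1 := ((u1 * j) %% d1)%N in
    let a2 := ((u2 * j) %% d2)%N in
    let b1 := ((u1 * j) %/ d1)%N in
    let b2 := ((u2 * j) %/ d2)%N in
    let jump1 := (b1 - (u1 * j.-1) %/ d1)%N in
    let jump2 := (b2 - (u2 * j.-1) %/ d2)%N in
    if (jump1 == 0%N) && (jump2 == 0%N) then
      [:: ReesGen true (mon (d1 - a1) (d2 - a2) 0 j 0)
                       (mon 0 0 b1.+1 0 b2.+1)]
    else if (jump1 == 1%N) && (jump2 == 1%N) then
      [:: ReesGen false (mon 0 0 0 j 0) (mon a1 a2 b1 0 b2)]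
    else
      let up := (max1 < a1)%N && (a2 < min2)%N in
      let low := (a1 < min1)%N && (max2 < a2)%N in
      (if up then
         [:: ReesGen true (mon (d1 - a1) 0 0 j 0) (mon 0 a2 b1.+1 0 b2)]
       else [::]) ++
      (if low then
         [:: ReesGen false (mon 0 (d2 - a2) 0 j 0) (mon a1 0 b1 0 b2.+1)]
       else [::]) ++
      (if (a1 == 0%N) || (a2 == 0%N) then [::]
       else rees_loop d1 d2 u1 u2 fuel' j.+1
              (if up then a1 else max1) (if low then a1 else min1)
              (if low then a2 else max2) (if up then a2 else min2))
  else [::].

(* The loop stops at some j <= d1, since a1 = 0 for j = d1; hence the fuel d1
   is never exhausted (rees_loop_fuel below). *)
Definition rees_gens (d1 d2 u1 u2 : nat) : seq rees_gen :=
  [:: ReesGen true (mon (d1 - u1) 0 0 1 0) (mon 0 u2 1 0 0),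
      ReesGen false (mon 0 (d2 - u2) 0 1 0) (mon u1 0 0 0 1)
    & rees_loop d1 d2 u1 u2 d1 2 u1 u1 u2 u2].

Lemma rees_loop_fuel (d1 d2 u1 u2 j max1 min1 max2 min2 n : nat) :
  (0 < u1 < d1)%N -> (0 < j <= d1)%N -> (d1 <= n + j.-1)%N ->
  rees_loop d1 d2 u1 u2 n j max1 min1 max2 min2 =
  rees_loop d1 d2 u1 u2 (d1 - j.-1) j max1 min1 max2 min2.
Proof.
move=> hu; elim: n j max1 min1 max2 min2 => [|n IH] j M1 m1 M2 m2 hj hn.
  by have -> : (d1 - j.-1 = 0)%N by lia.
have -> : (d1 - j.-1 = (d1 - j).+1)%N by lia.
rewrite /=; case: ifP => // _; case: ifP => // _; congr (_ ++ (_ ++ _)).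
case: ifP => // /norP[a1 _].
have hjd : (j < d1)%N.
  rewrite ltn_neqAle; case/andP: hj => _ ->; rewrite andbT.
  by apply/eqP => ejd; rewrite ejd modnMl in a1.
by rewrite IH //=; lia.
Qed.

(* In the graph, node g_i of the list g is the ordinal i - 1. *)

(* Edges into the nodes i, i+1, ..., whose rows are given by rows (true for the
   top row), where top and bot are the current rightmost nodes. *)
Fixpoint graph_edges (rows : seq bool) (i top bot : nat) : seq (nat * nat) :=
  if rows is up :: rows' then
    [:: (top, i), (bot, i)
      & graph_edges rows' i.+1 (if up then i else top) (if up then bot else i)]
  else [::].

Definition edge (g : seq rees_gen) (j k : 'I_(size g)) : bool :=
  (val j, val k) \in graph_edges (drop 2 (map is_upper g)) 2 0 1.

Definition triangle (g : seq rees_gen) (j k l : 'I_(size g)) : bool :=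
  [&& edge j k, edge j l & edge k l].

Definition other_source (g : seq rees_gen) (j k h : 'I_(size g)) : bool :=
  edge h k && (h != j).

Lemma graph_edges_lt rows i top bot a c :
  (a, c) \in graph_edges rows i top bot -> (i <= c)%N.
Proof.
elim: rows i top bot => //= up rows IH i top bot.
by rewrite !inE => /or3P[/eqP[_ ->]|/eqP[_ ->]|/IH /ltnW].
Qed.

Lemma graph_edges_other rows i top bot a c :
  (top < i)%N -> (bot < i)%N -> top != bot ->
  (a, c) \in graph_edges rows i top bot ->
  exists b, [/\ (b < c)%N, b != a, (b, c) \in graph_edges rows i top bot &
    forall b', (b', c) \in graph_edges rows i top bot -> b' != a -> b' = b].
Proof.
elim: rows i top bot => //= up rows IH i top bot ht hb ntb.
have tailF x t b : (x, i) \notin graph_edges rows i.+1 t b.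
  by apply/negP => /graph_edges_lt; rewrite ltnn.
rewrite inE => /orP[/eqP[-> ->]|].
  exists bot; split=> //; rewrite ?inE ?eqxx ?orbT //; first by rewrite eq_sym.
  move=> b'; rewrite !inE (negPf (tailF _ _ _)) orbF !xpair_eqE eqxx !andbT.
  by case/orP=> [->|/eqP].
rewrite inE => /orP[/eqP[-> ->]|ac].
  exists top; split=> //; rewrite ?inE ?eqxx ?orbT //.
  move=> b'; rewrite !inE (negPf (tailF _ _ _)) orbF !xpair_eqE eqxx !andbT.
  by case/orP=> [/eqP|->].
have lt_ic := graph_edges_lt ac.
have [||| b [lt_bc nba bc ub]] := IH _ _ _ _ _ _ ac.
- by case: (up) => //; exact: ltnW.
- by case: (up) => //; exact: ltnW.
- by case: (up); rewrite neq_ltn ?ht ?hb ?orbT.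
exists b; split=> //; first by rewrite !inE bc !orbT.
move=> b'; rewrite !inE !xpair_eqE (gtn_eqF lt_ic) !andbF /=; exact: ub.
Qed.

Lemma other_source_unique (g : seq rees_gen) (j k : 'I_(size g)) :
  edge j k -> exists! h, other_source j k h.
Proof.
case/graph_edges_other => // b [lt_bk nbj bk ub].
exists (Ordinal (ltn_trans lt_bk (ltn_ord k))); split.
  by apply/andP; split.
by move=> h /andP[hk nhj]; apply: val_inj; rewrite /= (ub h).
Qed.

Definition edge_type (g : seq rees_gen) : finType :=
  {e : 'I_(size g) * 'I_(size g) | edge e.1 e.2}.

Definition triangle_type (g : seq rees_gen) : finType :=
  {t : 'I_(size g) * 'I_(size g) * 'I_(size g) | triangle t.1.1 t.1.2 t.2}.

(* The free S-module with basis J. *)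
Notation freemod S J := {ffun J -> S^o}.

Definition basis_vec (S : pzRingType) (J : finType) (x : J) : freemod S J :=
  [ffun y => (y == x)%:R].

Section ReesGraphVectors.
Variables (K : fieldType) (g : seq rees_gen).
Implicit Types j k l : 'I_(size g).
Local Notation S := {mpoly K[5]}.
Local Notation gen j := (tnth (in_tuple g) j).

Definition g_ j : S := gen_poly K (gen j).

Definition v_ j k : S :=
  'X_[mlcm (lead (gen j)) (lead (gen k)) - lead (gen j)].

Definition w_ j k : S :=
  'X_[[multinom minn (tail (gen j) i) (tail (gen k) i) | i < 5]].

Definition e_ j : freemod S 'I_(size g) := basis_vec S j.

(* f_ j k is the basis vector of the edge (j, k), and 0 if (j, k) is not an
   edge; similarly for t_ j k l. *)
Definition f_ j k : freemod S (edge_type g) :=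
  [ffun e => (val e == (j, k))%:R].

Definition t_ j k l : freemod S (triangle_type g) :=
  [ffun t => (val t == (j, k, l))%:R].

End ReesGraphVectors.

Arguments g_ {K g} j.
Arguments v_ {K g} j k.
Arguments w_ {K g} j k.
Arguments e_ {K g} j.
Arguments f_ {K g} j k.
Arguments t_ {K g} j k l.

Section FreeResolution.
Variables (K : fieldType) (n m : nat).
Local Notation S := {mpoly K[n]}.

(* The ideal generated by the variables. *)
Definition irrelevant_ideal (p : S) : Prop :=
  exists c : 'I_n -> S, p = \sum_i c i * 'X_i.

Variable deg : 'X_{1..n} -> 'X_{1..m}.

Definition homogeneous (d : 'X_{1..m}) (p : S) : Prop :=
  forall mu, mu \in msupp p -> deg mu = d.

(* phi preserves degrees, for the gradings of the free modules in which the
   basis vectors x and y have degrees dJ x and dL y. *)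
Definition graded_map (J L : finType) (dJ : J -> 'X_{1..m})
    (dL : L -> 'X_{1..m}) (phi : freemod S J -> freemod S L) : Prop :=
  forall x y mu, mu \in msupp (phi (basis_vec S x) y) ->
    (deg mu + dL y)%MM = dJ x.

Definition minimal_map (J L : finType)
    (phi : freemod S J -> freemod S L) : Prop :=
  forall x y, irrelevant_ideal (phi (basis_vec S x) y).

Definition exact_at (U V W : lmodType S) (f : U -> V) (h : V -> W) : Prop :=
  forall y, h y = 0 <-> exists x, f x = y.

(* 0 -> S^T -> S^E -> S^N -> I -> 0, multigraded by deg. *)
Definition minimal_free_resolution (I : pred S) (N E T : finType)
    (phi0 : {linear freemod S N -> S^o})
    (phi1 : {linear freemod S E -> freemod S N})
    (phi2 : {linear freemod S T -> freemod S E}) : Prop :=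
  [/\ [/\ forall p : S, p \in I <-> exists x, phi0 x = p,
          exact_at phi1 phi0, exact_at phi2 phi1 & injective phi2],
      exists dN dE dT, [/\ forall x, homogeneous (dN x) (phi0 (basis_vec S x)),
        graded_map dE dN phi1 & graded_map dT dE phi2]
    & minimal_map phi1 /\ minimal_map phi2].

End FreeResolution.

(* Main.v *)
Require Import Defs.
From HB Require Import structures.
From mathcomp Require Import all_boot all_order all_algebra.
From mathcomp Require Import zify ring.
From mathcomp.multinomials Require Import mpoly.
Set Implicit Arguments.
Unset Strict Implicit.
Unset Printing Implicit Defensive.
Import Order.TTheory GRing.Theory Num.Theory.
Local Open Scope ring_scope.

(** Write a binomial of the Rees ideal through the exponents of its X-part: a
pair (p, q) stands for X1^(p+q) over X0^p X2^q, and homogeneity forces the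
exponents of T0 and T1, namely d1 p - u1 (p+q) and d2 q - u2 (p+q), counted in
the leading monomial when positive and in the tail when negative.  So the
Rees ideal is the lattice ideal of a copy of Z^2, and the generators are
lattice vectors in its first quadrant.  The arithmetic of floors and residues
that produces them is a Stern-Brocot process: start with the basis (1, 0),
(0, 1), one vector upper (T0 in the lead, T1 in the tail) and one lower (T1 in
the lead, T0 in the tail), and repeatedly add the sum of the last upper and the
last lower vector, until that sum is of neither kind.  The two summands stay a
basis of Z^2; hence no lattice vector of smaller height p + q is a record or
stops the process (small_cone_dichotomy), and rees_gens_chain identifies the
list of generators with the chain of mediants.  The edges into a node of the Rees graph come from
the two summands of its vector, and a triangle is a node together with its two
summands, as soon as one of these is a summand of the other.

All the monomial identities between neighbours in the graph (syzygy of an edge,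
relation of a triangle) then compare truncated differences of the exponents of
v, w and v + w, and show that the maps form a complex.  Its exactness has three
parts.

Injectivity of the last map and exactness in the middle are triangular: the
edges into the largest node L of the support have coefficients at e_L that are
powers of T0 and of T1, so their syzygies are Koszul, and the triangle with
apex L realizes the Koszul syzygy.  This descends to the first node with two
incoming edges, whose Koszul syzygy maps to a multiple of a generator, which
is not zero (phi2_inj, ker_phi1).

For exactness at S^r, the generators, whose leads contain neither X0 nor X2, are
completed to a Groebner basis: the binomial T0^d1 X2 - T1^d2 X0 has to be added,
and it is the S-polynomial of the first two generators, hence the image of an
explicit vector.  Modulo the syzygies of the edges every vector has a normal
form whose coefficient at e_l, for l with incoming edges, contains no monomial
of the ideal (T0^a, T1^b) given by these edges (normalizable_e).  The terms of
a normal form have pairwise distinct leading monomials (lead_mon_inj), so that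
no nonzero normal form is in the kernel of phi0 (ker_phi0).

Finally the generators generate: for two monomials m, k of the same multidegree
the quotient is a lattice vector, and in the coordinates given by the final pair
of summands one finds a member of the Groebner basis whose lead divides m or k
(chain_covers, lead_mon_le).  Replacing lead by tail increases a bounded weight,
so m - k lies in the ideal of the generators (im_phi0_same_deg), and the kernel
of a monomial map is spanned by such differences (rmap_im_phi0). *)

(** * Mediant chains *)

(** A pair (p, q) is the lattice vector whose binomial has X1^(p+q) in the
leading and X0^p X2^q in the tail monomial. *)
Definition vec := (nat * nat)%type.

Definition height (v : vec) : nat := (v.1 + v.2)%N.

Definition addv (v w : vec) : vec := (v.1 + w.1, v.2 + w.2)%N.

(** The rightmost node of row b once the nodes 0, ..., k-1 are placed. *)
Fixpoint last_row (row : nat -> bool) (b : bool) (k : nat) : nat :=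
  if k is k'.+1 then if row k' == b then k' else last_row row b k' else 0%N.

Lemma last_row_ext row row' b k :
  (forall i, (i < k)%N -> row i = row' i) ->
  last_row row b k = last_row row' b k.
Proof.
elim: k => //= k IH h; rewrite h // IH // => i hi.
by apply: h; apply: ltnW.
Qed.

Section Chain.
Variables d1 d2 u1 u2 : nat.
Implicit Types v w : vec.

Definition upper v : bool := (u1 * height v < d1 * v.1)%N.

(** Truncated subtraction splits an exponent of either sign into its positive
part, in the lead, and its negative part, in the tail. *)
Definition node v : rees_gen :=
  ReesGen (upper v)
    (mon (d1 * v.1 - u1 * height v) (d2 * v.2 - u2 * height v) 0 (height v) 0)
    (mon (u1 * height v - d1 * v.1) (u2 * height v - d2 * v.2) v.1 0 v.2).

Definition strict_upper v : bool :=
  ((u1 * height v < d1 * v.1) && (d2 * v.2 < u2 * height v))%N.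

Definition strict_lower v : bool :=
  ((d1 * v.1 < u1 * height v) && (u2 * height v < d2 * v.2))%N.

Definition strict v : bool := strict_upper v || strict_lower v.

Local Notation top V := (last_row (fun i => upper (V i)) true).
Local Notation bot V := (last_row (fun i => upper (V i)) false).

Record mediant_prefix (V : nat -> vec) (n : nat) : Prop := MediantPrefix {
  chain_size : (2 <= n)%N;
  chain_first : V 0%N = (1, 0)%N;
  chain_second : V 1%N = (0, 1)%N;
  chain_mediant : forall k, (2 <= k < n)%N -> V k = addv (V (top V k)) (V (bot V k))
}.

(** A vector that is not strict has T-exponents of the same sign, or one of them
zero: this is the stopping rule of the process. *)
Record mediant_chain (V : nat -> vec) (r : nat) : Prop := MediantChain {
  chain_prefix :> mediant_prefix V r;
  chain_ge3 : (3 <= r)%N;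
  chain_strict : forall k, (k.+1 < r)%N -> strict (V k);
  chain_last : ~~ strict (V r.-1)
}.

(** The exponents of T0 and T1 of the Laurent monomial of the lattice vector
(p, q); they are linear, unlike their truncations in node. *)
Definition deg0 (p q : int) : int := d1%:Z * p - u1%:Z * (p + q).
Definition deg1 (p q : int) : int := d2%:Z * q - u2%:Z * (p + q).

Definition unimodular v w : Prop := (v.1 * w.2 = v.2 * w.1 + 1)%N.

Lemma unimodular_coords v w (p q : int) : unimodular v w ->
  exists x y : int, p = x * v.1%:Z + y * w.1%:Z /\ q = x * v.2%:Z + y * w.2%:Z.
Proof.
case: v w => [a b] [c e]; rewrite /unimodular /= => h.
exists (p * e%:Z - q * c%:Z), (q * a%:Z - p * b%:Z).
have {}h : a%:Z * e%:Z = b%:Z * c%:Z + 1 by lia.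
split.
  transitivity (p * (a%:Z * e%:Z - b%:Z * c%:Z)); last by ring.
  by rewrite h; ring.
transitivity (q * (a%:Z * e%:Z - b%:Z * c%:Z)); last by ring.
by rewrite h; ring.
Qed.

(** In the basis (v, w) a vector of height less than that of v + w cannot have
two positive coordinates.  One of them is at most 0 and the other is at least 1,
which puts the vector beyond v or beyond w. *)
Lemma cone_dichotomy v w (p q : int) :
  strict_upper v -> strict_lower w -> unimodular v w ->
  0 < p + q < (height v + height w)%N%:Z ->
  (deg0 v.1 v.2 <= deg0 p q /\ deg1 p q <= deg1 v.1 v.2) \/
  (deg1 w.1 w.2 <= deg1 p q /\ deg0 p q <= deg0 w.1 w.2).
Proof.
move=> sv sw uvw hpq; have [x [y [ep eq_]]] := unimodular_coords p q uvw.
have e0 : deg0 p q = x * deg0 v.1 v.2 + y * deg0 w.1 w.2.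
  by rewrite ep eq_ /deg0; ring.
have e1 : deg1 p q = x * deg1 v.1 v.2 + y * deg1 w.1 w.2.
  by rewrite ep eq_ /deg1; ring.
have eh : p + q = x * (height v)%:Z + y * (height w)%:Z.
  by rewrite ep eq_ /height; lia.
have [v0 v1] : 0 < deg0 v.1 v.2 /\ deg1 v.1 v.2 < 0.
  by move: sv; rewrite /strict_upper /deg0 /deg1 /height; lia.
have [w0 w1] : deg0 w.1 w.2 < 0 /\ 0 < deg1 w.1 w.2.
  by move: sw; rewrite /strict_lower /deg0 /deg1 /height; lia.
rewrite e0 e1; rewrite eh in hpq; move: hpq v0 v1 w0 w1.
move: (deg0 v.1 v.2) (deg1 v.1 v.2) (deg0 w.1 w.2) (deg1 w.1 w.2).
move=> {e0 e1 eh ep eq_ sv sw uvw}.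
have : 0 <= (height v)%:Z by [].
have : 0 <= (height w)%:Z by [].
rewrite PoszD.
move: (height v)%:Z (height w)%:Z => a b b0 a0 V0 V1 W0 W1 hpq v0 v1 w0 w1.
have [x1|x0] := lerP 1 x.
  have y0 : y <= 0 by rewrite leNgt; apply/negP => y1; nia.
  by left; nia.
have y1 : 1 <= y by rewrite leNgt; apply/negP => y1; nia.
by right; nia.
Qed.


Lemma small_cone_dichotomy v w (p q j : nat) :
  strict_upper v -> strict_lower w -> unimodular v w ->
  (p + q = j)%N -> (0 < j < height v + height w)%N ->
  (d1 * v.1 + u1 * j <= d1 * p + u1 * height v /\
   d2 * q + u2 * height v <= d2 * v.2 + u2 * j)%N \/
  (d2 * w.2 + u2 * j <= d2 * q + u2 * height w /\
   d1 * p + u1 * height w <= d1 * w.1 + u1 * j)%N.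
Proof.
move=> sv sw uvw ej hj.
have [|[h0 h1]|[h1 h0]] := cone_dichotomy (p := p%:Z) (q := q%:Z) sv sw uvw.
- by lia.
- left; move: h0 h1; rewrite /deg0 /deg1 -!PoszD ej -/(height v); lia.
- right; move: h0 h1; rewrite /deg0 /deg1 -!PoszD ej -/(height w); lia.
Qed.

Lemma floor_step (d u j : nat) : (0 < u < d)%N -> (0 < j)%N ->
  ((u * j) %/ d = (u * j.-1) %/ d \/ (u * j) %/ d = ((u * j.-1) %/ d).+1)%N.
Proof.
move=> hu j0; have d0 : (0 < d)%N by lia.
have := divn_eq (u * j)%N d; have := divn_eq (u * j.-1)%N d.
have := ltn_pmod (u * j)%N d0; have := ltn_pmod (u * j.-1)%N d0.
move: ((u * j) %/ d)%N ((u * j) %% d)%N ((u * j.-1) %/ d)%N ((u * j.-1) %% d)%N.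
have -> : (u * j = u * j.-1 + u)%N by rewrite -mulnSr prednK.
move: (u * j.-1)%N => x b a b' a' ha' ha e' e.
have h1 : (b' <= b)%N by rewrite leqNgt; apply/negP; nia.
have h2 : (b <= b'.+1)%N by rewrite leqNgt; apply/negP; nia.
lia.
Qed.

(** The floor and the residue of n are read off from a multiple of d that is at
distance less than d from n, on either side. *)
Lemma floor_of_near (d n b a p : nat) :
  (n = b * d + a)%N -> (a < d)%N -> (d * p < d + n)%N -> (n < d + d * p)%N ->
  (if n < d * p then p = b.+1 /\ a + d * p = d + n else p = b /\ a + d * p = n)%N.
Proof.
move=> e l h1 h2; case: ltnP => h.
  have ep : (p = b.+1)%N.
    have h3 : (b < p)%N by rewrite ltnNge; apply/negP; nia.
    have h4 : (p < b.+2)%N by rewrite ltnNge; apply/negP; nia.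
    lia.
  by split=> //; rewrite ep; lia.
have ep : (p = b)%N.
  have h3 : (p <= b)%N by rewrite leqNgt; apply/negP; nia.
  have h4 : (b <= p)%N by rewrite leqNgt; apply/negP; nia.
  lia.
by split=> //; rewrite ep; lia.
Qed.

Lemma last_row_lt row b k : (last_row row b k.+1 < k.+1)%N.
Proof.
rewrite /=; case: ifP => // _.
by elim: k => //= k IH; case: ifP => // _; apply: ltnW.
Qed.

Lemma mediant_prefix_ext V V' n : (forall i, (i < n)%N -> V i = V' i) ->
  mediant_prefix V n -> mediant_prefix V' n.
Proof.
move=> e [n2 e0 e1 eN]; split=> //; rewrite -?e //; try by lia.
move=> k /[dup] hk /andP[k2 kn]; rewrite -e // eN // /addv.
have el b : last_row (fun i => upper (V i)) b k =
            last_row (fun i => upper (V' i)) b k.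
  by apply: last_row_ext => i ik; rewrite e //; lia.
have hl b : (last_row (fun i => upper (V' i)) b k < n)%N.
  by elim: (k) kn => /= [|k' IH] h; [lia|case: ifP => _; [lia|apply: IH; lia]].
by rewrite !el !e.
Qed.

Lemma mediant_prefix_rcons vs x (V := nth (0, 0)%N vs) :
  mediant_prefix V (size vs) ->
  x = addv (V (top V (size vs))) (V (bot V (size vs))) ->
  mediant_prefix (nth (0, 0)%N (rcons vs x)) (size (rcons vs x)).
Proof.
move=> pV ex; set V' := nth _ (rcons vs x).
have eV i : (i < size vs)%N -> V i = V' i by move=> h; rewrite /V' nth_rcons h.
have [n2 e0 e1 eN] := mediant_prefix_ext eV pV.
rewrite size_rcons; split=> //; first by lia.
move=> k /andP[k2]; rewrite ltnS leq_eqVlt => /orP[/eqP ->|kn]; last first.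
  by apply: eN; rewrite k2.
rewrite {1}/V' nth_rcons ltnn eqxx ex.
have el b : last_row (fun i => upper (V i)) b (size vs) =
            last_row (fun i => upper (V' i)) b (size vs).
  by apply: last_row_ext => i ik; rewrite eV.
have hl b m : (0 < m)%N -> (last_row (fun i => upper (V' i)) b m < m)%N.
  case: m => // m _ /=; case: ifP => // _.
  by elim: m => //= m IH; case: ifP => // _; apply: ltnW.
by rewrite !el !eV // hl //; lia.
Qed.

(** Before the height of the mediant of v and w the algorithm does nothing: none
of the vectors with X-exponents next to the floors b1, b2 is a stopping vector or
a record, and none has a zero residue. *)
Lemma before_mediant v w (j b1 a1 b2 a2 : nat) :
  strict_upper v -> strict_lower w -> unimodular v w ->
  (0 < j < height v + height w)%N ->
  (u1 * j = b1 * d1 + a1)%N -> (a1 < d1)%N ->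
  (u2 * j = b2 * d2 + a2)%N -> (a2 < d2)%N ->
  [/\ (b1.+1 + b2.+1 <> j)%N, (b1 + b2 <> j)%N
    & (b1 + b2 + 1 = j)%N ->
      [/\ (a1 + d1 * v.1 <= d1 + u1 * height v)%N, (0 < a2)%N,
          (a2 + d2 * w.2 <= d2 + u2 * height w)%N & (0 < a1)%N]].
Proof.
move=> sv sw uvw hj e1 l1 e2 l2.
have D p q h := @small_cone_dichotomy v w p q j sv sw uvw h hj.
case/andP: sv => sv0 sv1; case/andP: sw => sw0 sw1.
rewrite e1 e2 in D; clear uvw hj e1 e2.
split=> [h|h|h].
- by have [[A B]|[A B]] := D _ _ h; clear D; lia.
- by have [[A B]|[A B]] := D _ _ h; clear D; lia.
- have hU : (b1.+1 + b2 = j)%N by lia.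
  have hL : (b1 + b2.+1 = j)%N by lia.
  by split; [have [[A B]|[A B]] := D _ _ hU|have [[A B]|[A B]] := D _ _ hU
    |have [[A B]|[A B]] := D _ _ hL|have [[A B]|[A B]] := D _ _ hL];
    clear D; lia.
Qed.

Hypothesis hu1 : (0 < u1 < d1)%N.
Hypothesis hu2 : (0 < u2 < d2)%N.

(** The state of the loop is the pair (v, w) of the last upper and the last lower
vector: its four registers are the residues of their T-exponents, and the loop
counter j moves up to the height of v + w, where the new generator appears.  The
hypothesis on the floors says that exactly one of them jumps in each earlier
step. *)
Lemma rees_loop_chain fuel j vs v w (V := nth (0, 0)%N vs) (n := size vs) :
  mediant_prefix V n -> (forall k, (k < n)%N -> strict (V k)) ->
  v = V (top V n) -> w = V (bot V n) ->
  strict_upper v -> strict_lower w -> unimodular v w ->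
  (height v < j)%N -> (height w < j)%N -> (j <= height v + height w)%N ->
  (2 <= j <= d1)%N -> (d1 < fuel + j)%N ->
  (d1 * v.1 < d1 + u1 * height v)%N -> (u1 * height w < d1 + d1 * w.1)%N ->
  (d2 * w.2 < d2 + u2 * height w)%N -> (u2 * height v < d2 + d2 * v.2)%N ->
  ((u1 * j.-1) %/ d1 + (u2 * j.-1) %/ d2 + 2 = j)%N ->
  exists s, mediant_chain (nth (0, 0)%N (vs ++ s)) (size (vs ++ s)) /\
    rees_loop d1 d2 u1 u2 fuel j
      (d1 + u1 * height v - d1 * v.1) (u1 * height w - d1 * w.1)
      (d2 + u2 * height w - d2 * w.2) (u2 * height v - d2 * v.2) =
    map node s.
Proof.
elim: fuel j vs v w @V @n => [|fuel IH] j vs v w V n pV sV ev ew sv sw uvw.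
  by lia.
move=> hvj hwj hj hjd hfuel bv0 bw0 bw1 bv1 hc /=.
have d10 : (0 < d1)%N by lia.
have d20 : (0 < d2)%N by lia.
have f1 := floor_step hu1 (ltnW (proj1 (andP hjd))).
have f2 := floor_step hu2 (ltnW (proj1 (andP hjd))).
have e1 := divn_eq (u1 * j)%N d1; have l1 := ltn_pmod (u1 * j)%N d10.
have e2 := divn_eq (u2 * j)%N d2; have l2 := ltn_pmod (u2 * j)%N d20.
have ad1 : ((u1 * j) %% d1 != 0)%N -> (j < d1)%N.
  move=> a1; rewrite ltn_neqAle; case/andP: hjd => _ ->; rewrite andbT.
  by apply/eqP => ej; rewrite ej modnMl in a1.
move: f1 f2 hc e1 e2 l1 l2 ad1.
set c1 := ((u1 * j.-1) %/ d1)%N; set c2 := ((u2 * j.-1) %/ d2)%N.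
set b1 := ((u1 * j) %/ d1)%N; set b2 := ((u2 * j) %/ d2)%N.
set a1 := ((u1 * j) %% d1)%N; set a2 := ((u2 * j) %% d2)%N.
have hb1 : ((u1 * j.+1.-1) %/ d1 = b1)%N by [].
have hb2 : ((u2 * j.+1.-1) %/ d2 = b2)%N by [].
clearbody c1 c2 b1 b2 a1 a2.
move=> f1 f2 hc e1 e2 l1 l2 ad1.
(* Before the height of the mediant nothing is appended. *)
have [hlt|hge] := ltnP j (height v + height w).
  have hj0 : (0 < j < height v + height w)%N by rewrite hlt andbT; lia.
  have [N1 N2 N3] := before_mediant sv sw uvw hj0 e1 l1 e2 l2.
  case: ifP => [/andP[/eqP h1 /eqP h2]|n1].
    by case: N1; move: f1 f2 h1 h2 hc; clear; lia.
  case: ifP => [/andP[/eqP h1 /eqP h2]|n2].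
    by case: N2; move: f1 f2 h1 h2 hc; clear; lia.
  have ej : (b1 + b2 + 1 = j)%N by move: f1 f2 n1 n2 hc; clear; lia.
  have [U1 U2 L1 L2] := N3 ej.
  have -> : (d1 + u1 * height v - d1 * v.1 < a1)%N = false.
    by apply/negbTE; rewrite -leqNgt; move: U1; clear; lia.
  have -> : (d2 + u2 * height w - d2 * w.2 < a2)%N = false.
    by apply/negbTE; rewrite -leqNgt; move: L1; clear; lia.
  rewrite andbF /= -!leqn0 leqNgt L2 leqNgt U2 /=.
  have jd : (j < d1)%N by apply: ad1; rewrite -lt0n.
  apply: IH => //; rewrite ?hb1 ?hb2.
  - exact: leqW.
  - exact: leqW.
  - by rewrite jd andbT; move: hjd; clear; lia.
  - by move: hfuel; clear; lia.
  - by move: ej; clear; lia.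
have {hge hj} ej : j = (height v + height w)%N by lia.
have em : height (addv v w) = j by rewrite ej /height /=; lia.
case/andP: (sv) => sv0 sv1; case/andP: (sw) => sw0 sw1.
have [B0 B0'] : (d1 * (v.1 + w.1) < d1 + u1 * j)%N /\
    (u1 * j < d1 + d1 * (v.1 + w.1))%N
  by rewrite ej; move: sv0 sv1 sw0 sw1 bv0 bv1 bw0 bw1; clear; lia.
have [B1 B1'] : (d2 * (v.2 + w.2) < d2 + u2 * j)%N /\
    (u2 * j < d2 + d2 * (v.2 + w.2))%N
  by rewrite ej; move: sv0 sv1 sw0 sw1 bv0 bv1 bw0 bw1; clear; lia.
have C1 := floor_of_near e1 l1 B0 B0'.
have C2 := floor_of_near e2 l2 B1 B1'.
have hPQ : (v.1 + w.1 + (v.2 + w.2) = j)%N by rewrite ej /height; clear; lia.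
(* At that height the signs of the T-exponents of x = v + w select the case. *)
set x := addv v w in em.
have pV' : mediant_prefix (nth (0, 0)%N (rcons vs x)) (size (rcons vs x)).
  by apply: mediant_prefix_rcons => //; rewrite /x ev ew.
have stop : ~~ strict x -> forall g, g = node x ->
    exists s, mediant_chain (nth (0, 0)%N (vs ++ s)) (size (vs ++ s)) /\
      [:: g] = map node s.
  move=> nx g ->; exists [:: x]; split=> //; rewrite cats1; split=> //.
  - by rewrite size_rcons; have := chain_size pV; rewrite /n; lia.
  - move=> k; rewrite size_rcons ltnS => kn.
    by rewrite nth_rcons kn; apply: sV.
  - by rewrite size_rcons /= nth_rcons ltnn eqxx.
have go v' w' : v' = (if upper x then x else v) -> w' = (if upper x then w else x) ->
    strict x -> (j < d1)%N ->
    exists s, mediant_chain (nth (0, 0)%N (vs ++ s)) (size (vs ++ s)) /\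
     node x :: rees_loop d1 d2 u1 u2 fuel j.+1
      (d1 + u1 * height v' - d1 * v'.1) (u1 * height w' - d1 * w'.1)
      (d2 + u2 * height w' - d2 * w'.2) (u2 * height v' - d2 * v'.2) =
     map node s.
  move=> ev' ew' sx jd.
  have eV i : (i < n)%N -> nth (0, 0)%N (rcons vs x) i = V i.
    by move=> h; rewrite nth_rcons h.
  have eL b : last_row (fun i => upper (nth (0, 0)%N (rcons vs x) i)) b n =
              last_row (fun i => upper (V i)) b n.
    by apply: last_row_ext => i hi; rewrite eV.
  have n0 : (0 < n)%N by have := chain_size pV; clear; lia.
  have hl b : (last_row (fun i => upper (V i)) b n < n)%N.
    by case: (n) n0 => // m _; apply: last_row_lt.
  have eN : nth (0, 0)%N (rcons vs x) n = x by rewrite nth_rcons ltnn eqxx.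
  have [sv'' sw'' uvw'] : [/\ strict_upper v', strict_lower w' & unimodular v' w'].
    rewrite ev' ew'; move: sx uvw; rewrite /strict /strict_upper /strict_lower.
    rewrite /unimodular /upper em /= => sx uvw; case: ifP => ux /=.
      rewrite em /= ?sv0 ?sv1 ?sw0 ?sw1; split=> //; last by move: uvw; clear; lia.
      by move: sx ux; clear; lia.
    rewrite em /= ?sv0 ?sv1 ?sw0 ?sw1; split=> //; last by move: uvw; clear; lia.
    by move: sx ux; clear; lia.
  have [s [cs es]] : exists s,
      mediant_chain (nth (0, 0)%N (rcons vs x ++ s)) (size (rcons vs x ++ s)) /\
      rees_loop d1 d2 u1 u2 fuel j.+1
      (d1 + u1 * height v' - d1 * v'.1) (u1 * height w' - d1 * w'.1)
      (d2 + u2 * height w' - d2 * w'.2) (u2 * height v' - d2 * v'.2) =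
      map node s.
    apply: IH => //; rewrite ?hb1 ?hb2.
    - move=> k; rewrite size_rcons ltnS leq_eqVlt => /orP[/eqP ->|kn].
        by rewrite eN.
      by rewrite eV //; apply: sV.
    - rewrite size_rcons /= eN ev'; case: ifP => ux; rewrite ?eN //=.
      by rewrite eL eV //.
    - rewrite size_rcons /= eN ew'; case: ifP => ux; rewrite ?eN //=.
      by rewrite eL eV //.
    - by rewrite ev'; case: ifP => _; rewrite ?em // leqW.
    - by rewrite ew'; case: ifP => _; rewrite ?em // leqW.
    - have hv0 : (0 < height v)%N by case: (height v) sv1 => //; rewrite muln0.
      have hw0 : (0 < height w)%N by case: (height w) sw0 => //; rewrite muln0.
      by rewrite ev' ew'; case: ifP => _; rewrite em; move: hv0 hw0; clear; lia.
    - by rewrite jd andbT; move: hjd; clear; lia.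
    - by move: hfuel; clear; lia.
    - by rewrite ev'; case: ifP => _; rewrite ?em.
    - by rewrite ew'; case: ifP => _; rewrite ?em.
    - by rewrite ew'; case: ifP => _; rewrite ?em.
    - by rewrite ev'; case: ifP => _; rewrite ?em.
    - move: C1 C2 hPQ sx; rewrite /strict /strict_upper /strict_lower em /=.
      case: ifP => k1; case: ifP => k2 [E1 _] [E2 _]; clear -k1 k2 E1 E2; lia.
  by exists (x :: s); rewrite -cat_rcons /= es.
have nx : node x = ReesGen (u1 * j < d1 * (v.1 + w.1))%N
    (mon (d1 * (v.1 + w.1) - u1 * j) (d2 * (v.2 + w.2) - u2 * j) 0 j 0)
    (mon (u1 * j - d1 * (v.1 + w.1)) (u2 * j - d2 * (v.2 + w.2))
         (v.1 + w.1) 0 (v.2 + w.2)).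
  by rewrite /node /upper em.
have sx : strict x = ((u1 * j < d1 * (v.1 + w.1)) && (d2 * (v.2 + w.2) < u2 * j)
    || (d1 * (v.1 + w.1) < u1 * j) && (u2 * j < d2 * (v.2 + w.2)))%N.
  by rewrite /strict /strict_upper /strict_lower em.
have ux : upper x = (u1 * j < d1 * (v.1 + w.1))%N by rewrite /upper em.
have hv0 : (d1 * v.1 <= d1 + u1 * height v)%N by exact: ltnW.
have hw0 : (d2 * w.2 <= d2 + u2 * height w)%N by exact: ltnW.
have top0 : (d1 * (v.1 + w.1) + u1 * height v < d1 * v.1 + u1 * j)%N.
  by rewrite ej; move: sw0; clear; lia.
have bot0 : (d1 * (v.1 + w.1) + u1 * height w > d1 * w.1 + u1 * j)%N.
  by rewrite ej; move: sv0; clear; lia.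
have top1 : (d2 * (v.2 + w.2) + u2 * height v > d2 * v.2 + u2 * j)%N.
  by rewrite ej; move: sw1; clear; lia.
have bot1 : (d2 * (v.2 + w.2) + u2 * height w < d2 * w.2 + u2 * j)%N.
  by rewrite ej; move: sv1; clear; lia.
case: (ltnP (u1 * j) (d1 * (v.1 + w.1))) C1 nx sx ux => s0 [E1 A1] nx sx ux;
case: (ltnP (u2 * j) (d2 * (v.2 + w.2))) C2 nx sx => s1 [E2 A2] nx sx.
- have [-> ->] : (b1 - c1 = 0)%N /\ (b2 - c2 = 0)%N.
    by move: E1 E2 hPQ f1 f2 hc; clear; lia.
  apply: stop; first by rewrite sx; move: s0 s1; clear; lia.
  rewrite nx; congr (ReesGen _ (mon _ _ _ _ _) (mon _ _ _ _ _));
  by move: s0 s1 A1 A2 E1 E2; clear; lia.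
- have -> : ((b1 - c1 == 0) && (b2 - c2 == 0))%N = false.
    by apply/negbTE; move: E1 E2 hPQ f1 f2 hc; clear; lia.
  have -> : ((b1 - c1 == 1) && (b2 - c2 == 1))%N = false.
    by apply/negbTE; move: E1 E2 hPQ f1 f2 hc; clear; lia.
  have -> : (d1 + u1 * height v - d1 * v.1 < a1)%N.
    by move: A1 top0 hv0; clear; lia.
  have -> : (a2 < u2 * height v - d2 * v.2)%N.
    by move: A2 top1 s1; clear; lia.
  have -> : (a1 < u1 * height w - d1 * w.1)%N = false.
    by apply/negbTE; rewrite ej in A1; move: A1 bv0 sv0; clear; lia.
  rewrite /=; have a10 : (0 < a1)%N by move: A1 B0; clear; lia.
  rewrite (gtn_eqF a10) /=.
  have -> : ReesGen true (mon (d1 - a1) 0 0 j 0) (mon 0 a2 b1.+1 0 b2) = node x.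
    rewrite nx; congr (ReesGen _ (mon _ _ _ _ _) (mon _ _ _ _ _));
    by move: s0 s1 A1 A2 E1 E2; clear; lia.
  case: ifP => a20.
    by apply: stop => //; rewrite sx; move: a20 A2; clear; lia.
  have [||||s [cs es]] := go x w; rewrite ?ux //.
  - by rewrite sx; move: a20 A2 s1; clear; lia.
  - by apply: ad1; rewrite -lt0n.
  exists s; split=> //; rewrite -es em /=; congr (_ :: rees_loop _ _ _ _ _ _ _ _ _ _).
  - by move: A1 hv0; clear; lia.
  - by move: A2 s1; clear; lia.
- have -> : ((b1 - c1 == 0) && (b2 - c2 == 0))%N = false.
    by apply/negbTE; move: E1 E2 hPQ f1 f2 hc; clear; lia.
  have -> : ((b1 - c1 == 1) && (b2 - c2 == 1))%N = false.
    by apply/negbTE; move: E1 E2 hPQ f1 f2 hc; clear; lia.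
  have -> : (a2 < u2 * height v - d2 * v.2)%N = false.
    by apply/negbTE; rewrite ej in A2; move: A2 bw1 sw1; clear; lia.
  have -> : (a1 < u1 * height w - d1 * w.1)%N.
    by move: A1 bot0 s0; clear; lia.
  have -> : (d2 + u2 * height w - d2 * w.2 < a2)%N.
    by move: A2 bot1 hw0; clear; lia.
  rewrite andbF /=; have a20 : (0 < a2)%N by move: A2 B1; clear; lia.
  rewrite (gtn_eqF a20) orbF.
  have -> : ReesGen false (mon 0 (d2 - a2) 0 j 0) (mon a1 0 b1 0 b2.+1) = node x.
    rewrite nx; congr (ReesGen _ (mon _ _ _ _ _) (mon _ _ _ _ _));
    by move: s0 s1 A1 A2 E1 E2; clear; lia.
  case: ifP => a10.
    by apply: stop => //; rewrite sx; move: a10 A1; clear; lia.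
  have [||||s [cs es]] := go v x; rewrite ?ux //.
  - by rewrite sx; move: a10 A1 s1 s0; clear; lia.
  - by apply: ad1; rewrite a10.
  exists s; split=> //; rewrite -es em /=; congr (_ :: rees_loop _ _ _ _ _ _ _ _ _ _).
  - by move: A1 s0; clear; lia.
  - by move: A2 s1 B1; clear; lia.
- have -> : ((b1 - c1 == 0) && (b2 - c2 == 0))%N = false.
    by apply/negbTE; move: E1 E2 hPQ f1 f2 hc; clear; lia.
  have [-> ->] : (b1 - c1 = 1)%N /\ (b2 - c2 = 1)%N.
    by move: E1 E2 hPQ f1 f2 hc; clear; lia.
  apply: stop; first by rewrite sx; move: s0 s1; clear; lia.
  rewrite nx; congr (ReesGen _ (mon _ _ _ _ _) (mon _ _ _ _ _));
  by move: s0 s1 A1 A2 E1 E2; clear; lia.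
Qed.

Lemma rees_gens_chain : exists vs,
  mediant_chain (nth (0, 0)%N vs) (size vs) /\ rees_gens d1 d2 u1 u2 = map node vs.
Proof.
pose vs := [:: (1, 0); (0, 1)]%N.
have e0 : upper (1, 0)%N = true.
  by rewrite /upper /height /= !muln1; lia.
have e1 : upper (0, 1)%N = false.
  by rewrite /upper /height /= !muln1 muln0; lia.
have s0 : strict_upper (1, 0)%N.
  by rewrite /strict_upper /height /= !muln1 muln0; lia.
have s1 : strict_lower (0, 1)%N.
  by rewrite /strict_lower /height /= !muln1 muln0; lia.
have [s [cs es]] : exists s, mediant_chain (nth (0, 0)%N (vs ++ s)) (size (vs ++ s)) /\
    rees_loop d1 d2 u1 u2 d1 2 (d1 + u1 * 1 - d1 * 1) (u1 * 1 - d1 * 0)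
      (d2 + u2 * 1 - d2 * 1) (u2 * 1 - d2 * 0) = map node s.
  apply: (@rees_loop_chain d1 2 vs (1, 0)%N (0, 1)%N).
  - by split=> // k; rewrite /=; lia.
  - by case=> [|[|k]] //= _; rewrite /strict ?s0 // s1 orbT.
  - by rewrite /= e0 e1.
  - by rewrite /= e0 e1.
  - by [].
  - by [].
  - by [].
  - by [].
  - by [].
  - by [].
  - by lia.
  - by lia.
  - by rewrite /height /=; lia.
  - by rewrite /height /=; lia.
  - by rewrite /height /=; lia.
  - by rewrite /height /=; lia.
  - by rewrite !muln1 !divn_small; lia.
exists (vs ++ s); split=> //.
rewrite map_cat -es /rees_gens /= /node e0 e1 /height /= !muln1 !muln0 !sub0n.
rewrite !subn0; congr [:: ReesGen _ (mon _ _ _ _ _) (mon _ _ _ _ _),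
  ReesGen _ (mon _ _ _ _ _) (mon _ _ _ _ _) & rees_loop _ _ _ _ _ _ _ _ _ _]; lia.
Qed.

Section ChainFacts.
Variables (V : nat -> vec) (r : nat).
Hypothesis cV : mediant_chain V r.

(** Unimodularity is preserved because one of the two vectors is replaced by
their sum. *)
Lemma chain_sources k : (2 <= k < r)%N ->
  [/\ (top V k < k)%N, (bot V k < k)%N, strict_upper (V (top V k)),
      strict_lower (V (bot V k)) & unimodular (V (top V k)) (V (bot V k))].
Proof.
have [[r2 V0 V1 Vk] r3 Vs _] := cV.
elim: k => // k IH /andP[k2 kr].
have [->|k1] := eqVneq k 1%N.
  have e0 : upper (1, 0)%N = true by rewrite /upper /height /= !muln1; lia.
  have e1 : upper (0, 1)%N = false by rewrite /upper /height /= !muln1; lia.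
  rewrite /= V0 V1 e0 e1 /= V0 V1; split=> //.
    by rewrite /strict_upper /height /= !muln1 muln0; lia.
  by rewrite /strict_lower /height /= !muln1 muln0; lia.
have hk : (2 <= k < r)%N by lia.
have [tk bk st sb uk] := IH hk; have := Vs _ kr; rewrite /strict.
have ek := Vk _ hk; move: st sb uk; rewrite /= ltnS.
rewrite {}/strict_upper {}/strict_lower /unimodular => st sb uk sk.
case hu: (upper (V k)); rewrite /upper in hu;
  rewrite /=; split; rewrite ?st ?sb //; try exact: ltnW.
- by case/orP: sk => // /andP[/ltnW]; rewrite leqNgt hu.
- by rewrite ek /=; move: uk; clear; lia.
- by case/orP: sk => // /andP[]; rewrite hu.
- by rewrite ek /=; move: uk; clear; lia.
Qed.

Lemma chain_prev k : (0 < k)%N ->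
  if upper (V k.-1) then top V k = k.-1 /\ bot V k = bot V k.-1
  else bot V k = k.-1 /\ top V k = top V k.-1.
Proof. by case: k => //= k _; case: (upper (V k)). Qed.

(** A new vector of a row is the previous one plus a vector of the other row, whose
exponent of T0 (in the upper row) or of T1 (in the lower row) is negative. *)
Lemma chain_earlier k i : (2 <= k < r)%N -> (i < k)%N ->
  if upper (V i) then
    (d1 * (V (top V k)).1 + u1 * height (V i) <=
     d1 * (V i).1 + u1 * height (V (top V k)))%N
  else (d2 * (V (bot V k)).2 + u2 * height (V i) <=
        d2 * (V i).2 + u2 * height (V (bot V k)))%N.
Proof.
elim: k i => // k IH i /andP[k2 kr].
have [_ V0 V1 Vk] := chain_prefix cV.
have [->|k1] := eqVneq k 1%N.
  rewrite /= V0 V1; have -> : upper (1, 0)%N = true.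
    by rewrite /upper /height /= !muln1; lia.
  have -> : upper (0, 1)%N = false by rewrite /upper /height /= !muln1; lia.
  case: i => [|[|]] //= _; rewrite ?V0 ?V1 /= ?V0 ?V1 /upper /height /=
    ?muln0 ?muln1; case: ltnP; lia.
have hk : (2 <= k < r)%N by lia.
have [_ _ /andP[t0 t1] /andP[b0 b1] _] := chain_sources hk.
have ek := Vk _ hk.
have eh : height (V k) = (height (V (top V k)) + height (V (bot V k)))%N.
  by rewrite ek /height /=; clear; lia.
rewrite ltnS leq_eqVlt => /orP[/eqP ->|ik].
  by rewrite /=; case: ifP => hu; rewrite hu.
have {IH} := IH i hk ik; rewrite /=; case: ifP => ui.
  case: (upper (V k)) => //=; rewrite eh ek /=.
  by move: b0; clear; lia.
case: (upper (V k)) => //=; rewrite eh ek /=.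
by move: t1; clear; lia.
Qed.

(** The leading monomial of v divides that of the lattice vector (p, q). *)
Definition covers (v : vec) (p q : int) : Prop :=
  [/\ (height v)%:Z <= p + q, deg0 v.1 v.2 <= 0 \/ deg0 v.1 v.2 <= deg0 p q
    & deg1 v.1 v.2 <= 0 \/ deg1 v.1 v.2 <= deg1 p q].

Lemma deg0_comb v w (x y : int) :
  deg0 (x * v.1%:Z + y * w.1%:Z) (x * v.2%:Z + y * w.2%:Z) =
  x * deg0 v.1 v.2 + y * deg0 w.1 w.2.
Proof. by rewrite /deg0; ring. Qed.

Lemma deg1_comb v w (x y : int) :
  deg1 (x * v.1%:Z + y * w.1%:Z) (x * v.2%:Z + y * w.2%:Z) =
  x * deg1 v.1 v.2 + y * deg1 w.1 w.2.
Proof. by rewrite /deg1; ring. Qed.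

Lemma strict_upper_deg v : strict_upper v ->
  [/\ 0 < deg0 v.1 v.2, deg1 v.1 v.2 < 0 & 0 < (height v)%:Z].
Proof.
rewrite /strict_upper /deg0 /deg1 -PoszD -/(height v) => /andP[h1 h2].
have h3 : (0 < height v)%N by case: (height v) h2 => //; rewrite muln0.
by split=> //; lia.
Qed.

Lemma strict_lower_deg v : strict_lower v ->
  [/\ deg0 v.1 v.2 < 0, 0 < deg1 v.1 v.2 & 0 < (height v)%:Z].
Proof.
rewrite /strict_lower /deg0 /deg1 -PoszD -/(height v) => /andP[h1 h2].
have h3 : (0 < height v)%N by case: (height v) h1 => //; rewrite muln0.
by split=> //; lia.
Qed.

Lemma comb_height v w (x y : int) :
  x * v.1%:Z + y * w.1%:Z + (x * v.2%:Z + y * w.2%:Z) =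
  x * (height v)%:Z + y * (height w)%:Z.
Proof. by rewrite /height; lia. Qed.

Lemma covers_upper v w (x y : int)
    (p := x * v.1%:Z + y * w.1%:Z) (q := x * v.2%:Z + y * w.2%:Z) :
  strict_upper v -> strict_lower w -> 1 <= x -> y <= 0 ->
  (height v)%:Z <= p + q -> covers v p q.
Proof.
move=> /strict_upper_deg[v0 v1 _] /strict_lower_deg[w0 w1 _] x1 y0 h.
split=> //; last by left; apply: ltW.
by right; rewrite deg0_comb; nia.
Qed.

Lemma covers_lower v w (x y : int)
    (p := x * v.1%:Z + y * w.1%:Z) (q := x * v.2%:Z + y * w.2%:Z) :
  strict_upper v -> strict_lower w -> x <= 0 -> 1 <= y ->
  (height w)%:Z <= p + q -> covers w p q.
Proof.
move=> /strict_upper_deg[v0 v1 _] /strict_lower_deg[w0 w1 _] x0 y1 h.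
split=> //; first by left; apply: ltW.
by right; rewrite deg1_comb; nia.
Qed.

(** Induction on the process: a vector outside the open cone of the current pair
is outside that of the previous pair, or lies between the old and the new
vector and is then covered by the new one. *)
Lemma covers_outside k (x y : int) (v := V (top V k)) (w := V (bot V k))
    (p := x * v.1%:Z + y * w.1%:Z) (q := x * v.2%:Z + y * w.2%:Z) :
  (2 <= k < r)%N -> 0 < p + q -> x <= 0 \/ y <= 0 ->
  exists2 i, (i < k)%N & covers (V i) p q.
Proof.
elim: k x y @v @w @p @q => // k IH x y v w p q hkS pq xy.
have [tk' bk' sv sw _] := chain_sources hkS.
rewrite -/v in sv; rewrite -/w in sw.
have [v0 v1 hv] := strict_upper_deg sv; have [w0 w1 hw] := strict_lower_deg sw.
have epq : p + q = x * (height v)%:Z + y * (height w)%:Z by apply: comb_height.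
have [_ V0 V1 Vk] := chain_prefix cV.
have [k1|k1] := eqVneq k 1%N.
  have e0 : upper (1, 0)%N = true by rewrite /upper /height /= !muln1; lia.
  have e1 : upper (0, 1)%N = false by rewrite /upper /height /= !muln1; lia.
  have [ev ew] : v = V 0%N /\ w = V 1%N.
    by rewrite /v /w k1 /= ?V1 ?V0 ?e1 ?e0 /= ?V0 ?e0 /= ?V0 ?V1.
  have hv1 : height v = 1%N by rewrite ev V0.
  have hw1 : height w = 1%N by rewrite ew V1.
  have pq1 : 1 <= p + q by [].
  have [x1|x0] := lerP 1 x.
    exists 0%N; rewrite ?k1 // -ev; apply: covers_upper => //; last by rewrite hv1.
    by case: xy => //; move: x1; clear; lia.
  have x0' : x <= 0 by move: x0; clear; lia.
  have y1 : 1 <= y by move: x0 pq1; rewrite epq hv1 hw1; clear; lia.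
  by exists 1%N; rewrite ?k1 // -ew; apply: covers_lower; rewrite ?hw1.
have hk : (2 <= k < r)%N by move: hkS k1; clear; lia.
have ek := Vk _ hk.
have := chain_prev (ltn0Sn k); rewrite [k.+1.-1]/=; case: (upper (V k)) => -[e e'].
  have [w' ev] : w = V (bot V k) /\ v = addv (V (top V k)) w.
    by rewrite /w e' /v e ek.
  have [ep eq_] : p = x * (V (top V k)).1%:Z + (x + y) * (V (bot V k)).1%:Z /\
                 q = x * (V (top V k)).2%:Z + (x + y) * (V (bot V k)).2%:Z.
    by rewrite /p /q ev w' /addv /=; clear; lia.
  have [h|[x1 xy1]] : (x <= 0 \/ x + y <= 0) \/ (1 <= x /\ 1 <= x + y).
    by clear; lia.
    have [||i ik ci] := IH x (x + y) hk; rewrite -?ep -?eq_ //.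
    by exists i; [exact: leqW | rewrite ep eq_].
  exists k => //; have -> : V k = v by rewrite /v e.
  apply: covers_upper => //; first by case: xy x1 => //; clear; lia.
  have hvw : (height w)%:Z <= (height v)%:Z.
    by rewrite ev /height /=; clear; lia.
  by rewrite epq; move: x1 xy1 xy hvw hw; clear; nia.
have [v' ew] : v = V (top V k) /\ w = addv v (V (bot V k)).
  by rewrite /v e' /w e ek.
have [ep eq_] : p = (x + y) * (V (top V k)).1%:Z + y * (V (bot V k)).1%:Z /\
                q = (x + y) * (V (top V k)).2%:Z + y * (V (bot V k)).2%:Z.
  by rewrite /p /q ew v' /addv /=; clear; lia.
have [h|[y1 xy1]] : (x + y <= 0 \/ y <= 0) \/ (1 <= y /\ 1 <= x + y).
  by clear; lia.
  have [||i ik ci] := IH (x + y) y hk; rewrite -?ep -?eq_ //.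
  by exists i; [exact: leqW | rewrite ep eq_].
exists k => //; have -> : V k = w by rewrite /w e.
apply: covers_lower => //; first by case: xy y1 => //; clear; lia.
have hvw : (height v)%:Z <= (height w)%:Z.
  by rewrite ew /height /=; clear; lia.
by rewrite epq; move: y1 xy1 xy hvw hv; clear; nia.
Qed.

(** The final mediant has T-exponents of weakly the same sign.  Inside the last
cone it therefore covers if both are nonpositive, or on the diagonal; off the
diagonal the summand with the larger coordinate does. *)
Lemma chain_covers (p q : int) : 0 < p + q ->
  exists2 i, (i < r)%N & covers (V i) p q.
Proof.
move=> pq; have r3 := chain_ge3 cV; set k := r.-1.
have hk : (2 <= k < r)%N by rewrite /k; move: r3; clear; lia.
have [tk bk sv sw uvw] := chain_sources hk.
have [x [y [ep eq_]]] := unimodular_coords p q uvw.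
have [xy|[x1 y1]] : (x <= 0 \/ y <= 0) \/ (1 <= x /\ 1 <= y) by clear; lia.
  have [||i ik ci] := covers_outside (x := x) (y := y) hk; rewrite -?ep -?eq_ //.
  exists i; last by rewrite ep eq_.
  by apply: (ltn_trans ik); case/andP: hk.
have [v0 v1 hv] := strict_upper_deg sv; have [w0 w1 hw] := strict_lower_deg sw.
have ek := chain_mediant cV hk; have := chain_last cV; rewrite -/k => ns.
move: tk bk sv sw v0 v1 hv w0 w1 hw ep eq_ ek {uvw}.
move: (top V k) (bot V k) => t b tk bk sv sw v0 v1 hv w0 w1 hw ep eq_ ek.
have eh : (height (V k))%:Z = (height (V t))%:Z + (height (V b))%:Z.
  by rewrite ek /height /=; clear; lia.
have e0 : deg0 (V k).1 (V k).2 = deg0 (V t).1 (V t).2 + deg0 (V b).1 (V b).2.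
  by rewrite ek /addv /deg0 /=; clear; lia.
have e1 : deg1 (V k).1 (V k).2 = deg1 (V t).1 (V t).2 + deg1 (V b).1 (V b).2.
  by rewrite ek /addv /deg1 /=; clear; lia.
have epq : p + q = x * (height (V t))%:Z + y * (height (V b))%:Z.
  by rewrite ep eq_ comb_height.
have ed0 : deg0 p q = x * deg0 (V t).1 (V t).2 + y * deg0 (V b).1 (V b).2.
  by rewrite ep eq_ deg0_comb.
have ed1 : deg1 p q = x * deg1 (V t).1 (V t).2 + y * deg1 (V b).1 (V b).2.
  by rewrite ep eq_ deg1_comb.
have {}ns : (deg0 (V k).1 (V k).2 <= 0 /\ deg1 (V k).1 (V k).2 <= 0) \/
  (0 <= deg0 (V k).1 (V k).2 /\ 0 <= deg1 (V k).1 (V k).2).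
  have n1 : ~ strict_upper (V k) by move=> h; rewrite /strict h in ns.
  have n2 : ~ strict_lower (V k) by move=> h; rewrite /strict h orbT in ns.
  move: n1 n2; rewrite /strict_upper /strict_lower /deg0 /deg1 -PoszD -/(height _).
  by clear; lia.
have kr : (k < r)%N by case/andP: hk.
have lt_r i : (i < k)%N -> (i < r)%N by move=> h; apply: ltn_trans kr.
case: ns => -[n0 n1].
  exists k => //; split; rewrite ?epq ?eh; [|by left|by left].
  by move: x1 y1 hv hw; clear; nia.
have {}lt_r i : (i < k)%N -> (i < r)%N by move=> h; apply: ltn_trans kr.
rewrite e0 in n0; rewrite e1 in n1.
have [xy|xy|xy] := ltrgtP x y.
- exists b; first exact: lt_r.
  split; rewrite ?epq ?ed0 ?ed1; [|by left; apply: ltW|right].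
    by move: x1 xy hv hw; clear; nia.
  by move: x1 xy n1 w1; clear; nia.
- exists t; first exact: lt_r.
  split; rewrite ?epq ?ed0 ?ed1; [|right|by left; apply: ltW].
    by move: y1 xy hv hw; clear; nia.
  by move: y1 xy n0 v0; clear; nia.
- exists k => //; rewrite xy in epq ed0 ed1.
  split; rewrite ?epq ?ed0 ?ed1 ?eh ?e0 ?e1; [|right|right].
  + by move: y1 hv hw; clear; nia.
  + by move: y1 n0; clear; nia.
  + by move: y1 n1; clear; nia.
Qed.

End ChainFacts.

End Chain.

(** * The Rees graph *)

Lemma graph_edges_last_row (row : nat -> bool) rows i a c :
  (forall m, (m < size rows)%N -> nth false rows m = row (i + m)%N) ->
  ((a, c) \in graph_edges rows i (last_row row true i) (last_row row false i)) =
  (i <= c < i + size rows)%N &&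
  ((a == last_row row true c) || (a == last_row row false c)).
Proof.
elim: rows i => [|up rows IH] i hr /=.
  by rewrite addn0; case: leqP => //= h; rewrite ltnNge h.
have hup : up = row i by have := hr 0%N; rewrite addn0; apply.
have -> : (if up then i else last_row row true i) = last_row row true i.+1.
  by rewrite /= hup; case: (row i).
have -> : (if up then last_row row false i else i) = last_row row false i.+1.
  by rewrite /= hup; case: (row i).
rewrite !inE IH; last by move=> m hm; rewrite addSnnS -hr.
rewrite !xpair_eqE addnS addSn; case: (eqVneq c i) => [->|nci] /=.
  by rewrite !andbT ltnn leqnn /= ltnS leq_addr /= orbF.
by rewrite !andbF /= (leq_eqVlt i) (eq_sym i) (negPf nci).
Qed.

Section Graph.
Variables d1 d2 u1 u2 : nat.
Hypothesis hu1 : (0 < u1 < d1)%N.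
Hypothesis hu2 : (0 < u2 < d2)%N.
Variable vs : seq vec.
Local Notation V := (nth (0, 0)%N vs).
Hypothesis cV : mediant_chain d1 d2 u1 u2 V (size vs).
Local Notation g := (map (node d1 d2 u1 u2) vs).
Local Notation r := (size g).
Local Notation row := (fun i => upper d1 u1 (V i)).
Implicit Types j k l h : 'I_r.

Lemma size_g : r = size vs. Proof. exact: size_map. Qed.

Lemma ge3_r : (3 <= r)%N.
Proof. by rewrite size_g; apply: chain_ge3 cV. Qed.

Lemma gt0_r : (0 < r)%N. Proof. exact: ltn_trans ge3_r. Qed.

Definition node_ord (i : nat) : 'I_r := insubd (Ordinal gt0_r) i.

Lemma val_node_ord i : (i < r)%N -> node_ord i = i :> nat.
Proof. by move=> h; rewrite val_insubd h. Qed.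

(** The two sources of the edges into k: the upper one for b = true, the lower
one for b = false. *)
Definition src (b : bool) k : 'I_r := node_ord (last_row row b k).

Lemma last_row_ltk b k : (2 <= k)%N -> (last_row row b k < k)%N.
Proof.
by case: (nat_of_ord k) => // m _; apply: last_row_lt.
Qed.

Lemma val_src b k : (2 <= k)%N -> src b k = last_row row b k :> nat.
Proof. by move=> k2; rewrite val_node_ord // (ltn_trans (last_row_ltk b k2)). Qed.

Lemma src_lt b k : (2 <= k)%N -> (src b k < k)%N.
Proof. by move=> k2; rewrite val_src // last_row_ltk. Qed.

Lemma edgeE j k : edge j k = (2 <= k)%N && ((j == src true k) || (j == src false k)).
Proof.
have [_ V0 V1 _] := chain_prefix cV.
have e0 : row 0%N = true by rewrite V0 /upper /height /= !muln1; lia.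
have e1 : row 1%N = false by rewrite V1 /upper /height /= !muln1; lia.
have tE : last_row row true 2 = 0%N by rewrite /= e0 e1.
have bE : last_row row false 2 = 1%N by rewrite /= e0 e1.
rewrite /edge -[0%N in X in graph_edges _ _ X _]tE -[1%N in X in graph_edges _ _ _ X]bE.
rewrite graph_edges_last_row; last first.
  move=> m; rewrite size_drop size_map => hm; rewrite nth_drop.
  rewrite (nth_map (node d1 d2 u1 u2 (0, 0)%N)) -?ltn_subRL //.
  by rewrite (nth_map (0, 0)%N) // -ltn_subRL -size_g.
have -> : (2 + size (drop 2 (map is_upper g)) = r)%N.
  by rewrite size_drop size_map subnKC // ltnW // ge3_r.
rewrite ltn_ord andbT; case k2: (2 <= k)%N => //=.
by rewrite -(inj_eq val_inj) /= -(inj_eq val_inj) /= !val_src.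
Qed.

Lemma src_strict k : (2 <= k)%N ->
  strict_upper d1 d2 u1 u2 (V (src true k)) /\
  strict_lower d1 d2 u1 u2 (V (src false k)).
Proof.
move=> k2; rewrite !val_src //.
have hk : (2 <= k < size vs)%N by rewrite k2 -size_g ltn_ord.
by have [] := chain_sources hu1 hu2 cV hk.
Qed.

Lemma src_mediant k : (2 <= k)%N -> V k = addv (V (src true k)) (V (src false k)).
Proof.
move=> k2; rewrite !val_src //.
by apply: (chain_mediant cV); rewrite k2 -size_g ltn_ord.
Qed.

Lemma src_row b k : (2 <= k)%N -> row (src b k) = b.
Proof.
move=> k2; have [/andP[t _] /andP[f _]] := src_strict k2.
by case: b => //; apply/negbTE; rewrite /upper -leqNgt ltnW.
Qed.

Lemma src_neq b b' k : (2 <= k)%N -> (src b k == src b' k) = (b == b').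
Proof.
move=> k2; case: (eqVneq b b') => [->|]; first by rewrite eqxx.
by apply: contraNF => /eqP e; rewrite -(src_row b k2) e src_row.
Qed.

Lemma edgeP j k : reflect (2 <= k /\ exists b, j = src b k)%N (edge j k).
Proof.
rewrite edgeE; apply: (iffP andP) => [[k2 /orP[]/eqP ->]|[k2 [b ->]]].
- by split=> //; exists true.
- by split=> //; exists false.
- by case: b; rewrite eqxx ?orbT.
Qed.

Lemma edge_src b k : (2 <= k)%N -> edge (src b k) k.
Proof. by move=> k2; apply/edgeP; split=> //; exists b. Qed.

Lemma other_sourceP b k h : (2 <= k)%N ->
  other_source (src b k) k h = (h == src (~~ b) k).
Proof.
move=> k2; rewrite /other_source edgeE k2 /=.
have ntf : (src true k == src false k) = false by rewrite src_neq.
case: b => /=.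
  by case: (eqVneq h (src true k)) => [->|_]; rewrite /= ?ntf ?andbT.
case: (eqVneq h (src false k)) => [->|_]; first by rewrite andbF eq_sym ntf.
by rewrite orbF andbT.
Qed.

(** One of the sources of l is its predecessor k; the other one has not changed
since k was placed. *)
Lemma src_pred k l : (2 <= k)%N -> k.+1 = l :> nat ->
  src (row k) l = k /\ src (~~ row k) l = src (~~ row k) k.
Proof.
move=> k2 kl; have l2 : (2 <= l)%N by rewrite -kl ltnW.
have hr : (k.+1 < r)%N by rewrite kl.
split; apply: val_inj; rewrite /= ?val_src // -kl /= ?eqxx //.
by case: (row k).
Qed.

(** Two of the nodes j, k, l of a triangle are the sources of l, so k = l - 1
and j is the common source of k and l in the other row. *)
Lemma triangleP j k l :
  reflect [/\ (2 <= k)%N, k.+1 = l :> nat & j = src (~~ row k) k] (triangle j k l).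
Proof.
apply: (iffP and3P) => [[/edgeP[k2 [b ej]] /edgeP[l2 [b1 ej1]] /edgeP[_ [b2 ek]]]|].
  have jk : (j < k)%N by rewrite ej src_lt.
  have lk : (k < l)%N by rewrite ek src_lt.
  have r1 : (l.-1 < r)%N by rewrite (leq_ltn_trans (leq_pred _) (ltn_ord l)).
  pose m := Ordinal r1; have ml : m.+1 = l :> nat by rewrite /= prednK // ltnW.
  have m2 : (2 <= m)%N by rewrite -ltnS ml (leq_ltn_trans k2 lk).
  have [e1 e2] := src_pred m2 ml.
  have b12 : b1 != b2.
    by apply/eqP => e; move: jk; rewrite ej1 ek e ltnn.
  have [eb|nb] := eqVneq b2 (row m).
    have km : k = m by rewrite ek eb.
    rewrite km; split=> //; rewrite -e2 ej1; congr src.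
    by rewrite -eb; case: (b1) (b2) b12 => [] [].
  have jm : j = m.
    by rewrite ej1 -e1; congr src; case: (b1) (b2) (row m) b12 nb => [] [] [].
  by move: jk lk; rewrite jm -ml ltnS => h1 h2; move: (leq_trans h1 h2); rewrite ltnn.
move=> [k2 kl ->]; have [e1 e2] := src_pred k2 kl.
have l2 : (2 <= l)%N by rewrite -kl ltnW.
split; first exact: edge_src.
  by rewrite -e2 edge_src.
by rewrite -{1}e1 edge_src.
Qed.

(** Two edges for each node of index at least 2. *)
Lemma card_edges : #|{: edge_type g}| = (2 * (r - 2))%N.
Proof.
rewrite card_sig.
pose f (x : 'I_(r - 2) * bool) := (src x.2 (node_ord x.1.+2), node_ord x.1.+2).
have vf (i : 'I_(r - 2)) : node_ord i.+2 = i.+2 :> nat.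
  by rewrite val_node_ord //; have := ltn_ord i; clear; lia.
have injf : injective f.
  move=> [i b] [i' b'] [] /= e1 e2; have ei : i = i'.
    by apply: val_inj; have := congr1 val e2; rewrite /= !vf => -[].
  subst i'; congr (_, _); apply/eqP; rewrite -(@src_neq b b' (node_ord i.+2)) ?vf //.
  by apply/eqP.
transitivity #|codom f|; last first.
  by rewrite card_codom // card_prod card_ord card_bool mulnC.
apply: eq_card => -[j k]; rewrite !inE; apply/idP/codomP => [/edgeP[/= k2 [b ->]]|].
  have hk : (k - 2 < r - 2)%N by have := ltn_ord k; move: k2; clear; lia.
  exists (Ordinal hk, b); rewrite /f /=.
  have -> // : node_ord (k - 2).+2 = k.
  by apply: val_inj; rewrite /= val_node_ord; have := ltn_ord k; move: k2; clear; lia.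
by case=> -[i b] [-> ->]; apply: edge_src; rewrite vf.
Qed.

(** One triangle for each apex of index at least 3. *)
Lemma card_triangles : #|{: triangle_type g}| = (r - 3)%N.
Proof.
rewrite card_sig.
pose f (x : 'I_(r - 3)) :=
  (src (~~ row (node_ord x.+2)) (node_ord x.+2), node_ord x.+2, node_ord x.+3).
have vf (i : 'I_(r - 3)) : node_ord i.+2 = i.+2 :> nat /\ node_ord i.+3 = i.+3 :> nat.
  by rewrite !val_node_ord //; have := ltn_ord i; clear; lia.
have injf : injective f.
  move=> i i' [] _ e2 _; apply: val_inj; move/(congr1 val): e2.
  by rewrite /= !(proj1 (vf _)) => -[].
transitivity #|codom f|; last by rewrite card_codom // card_ord.
apply: eq_card => -[[j k] l]; rewrite !inE.
apply/idP/codomP => [/triangleP[/= k2 kl ->]|].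
  have hk : (k - 2 < r - 3)%N by have := ltn_ord l; move: k2 kl; clear; lia.
  exists (Ordinal hk); rewrite /f /=.
  have -> : node_ord (k - 2).+2 = k.
    by apply: val_inj; rewrite /= val_node_ord; have := ltn_ord k; move: k2; clear; lia.
  congr (_, _); apply: val_inj; rewrite /= val_node_ord;
    by have := ltn_ord l; move: k2 kl; clear; lia.
by case=> i [-> -> ->]; have [e2 e3] := vf i; apply/triangleP; rewrite /= e2 e3.
Qed.

End Graph.

(** * Monomial identities between neighbours *)

Lemma monE t0 t1 x0 x1 x2 (i : 'I_5) :
  mon t0 t1 x0 x1 x2 i = nth 0%N [:: t0; t1; x0; x1; x2] i.
Proof. by rewrite (mnm_nth 0%N). Qed.

Lemma mon_add a b c d e a' b' c' d' e' :
  (mon a b c d e + mon a' b' c' d' e')%MM =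
  mon (a + a') (b + b') (c + c') (d + d') (e + e').
Proof.
by apply/mnmP => i; rewrite mnmDE !monE; case: i => [[|[|[|[|[|]]]]]].
Qed.

Lemma mon_sub a b c d e a' b' c' d' e' :
  (mon a b c d e - mon a' b' c' d' e')%MM =
  mon (a - a') (b - b') (c - c') (d - d') (e - e').
Proof.
by apply/mnmP => i; rewrite mnmBE !monE; case: i => [[|[|[|[|[|]]]]]].
Qed.

Lemma mon_lcm a b c d e a' b' c' d' e' :
  mlcm (mon a b c d e) (mon a' b' c' d' e') =
  mon (maxn a a') (maxn b b') (maxn c c') (maxn d d') (maxn e e').
Proof.
by apply/mnmP => i; rewrite mnmE !monE; case: i => [[|[|[|[|[|]]]]]].
Qed.

Definition iT0 : 'I_5 := Ordinal (isT : 0 < 5)%N.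
Definition iT1 : 'I_5 := Ordinal (isT : 1 < 5)%N.
Definition iX0 : 'I_5 := Ordinal (isT : 2 < 5)%N.
Definition iX1 : 'I_5 := Ordinal (isT : 3 < 5)%N.
Definition iX2 : 'I_5 := Ordinal (isT : 4 < 5)%N.

Lemma mon_le a b c e f (m : 'X_{1..5}) : (mon a b c e f <= m)%MM =
  [&& a <= m iT0, b <= m iT1, c <= m iX0, e <= m iX1 & f <= m iX2]%N.
Proof.
apply/mnm_lepP/and5P => [h|[h0 h1 h2 h3 h4] i].
  split; [have := h iT0|have := h iT1|have := h iX0|have := h iX1|have := h iX2];
    by rewrite monE.
rewrite monE; case: i => [[|[|[|[|[|]]]]] hi] //;
  by rewrite (bool_irrelevance hi isT).
Qed.

Definition mgcd (m n : 'X_{1..5}) : 'X_{1..5} := [multinom minn (m i) (n i) | i < 5].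

Lemma mon_gcd a b c d e a' b' c' d' e' :
  mgcd (mon a b c d e) (mon a' b' c' d' e') =
  mon (minn a a') (minn b b') (minn c c') (minn d d') (minn e e').
Proof.
by apply/mnmP => i; rewrite mnmE !monE; case: i => [[|[|[|[|[|]]]]]].
Qed.

Section Nodes.
Variables d1 d2 u1 u2 : nat.
Local Notation N := (node d1 d2 u1 u2).
Local Notation strict_upper := (strict_upper d1 d2 u1 u2).
Local Notation strict_lower := (strict_lower d1 d2 u1 u2).
Implicit Types v w x y : vec.

(** The exponents of the monomials v_ and w_ of the resolution. *)
Definition vmon v w : 'X_{1..5} := (mlcm (lead (N v)) (lead (N w)) - lead (N v))%MM.
Definition wmon v w : 'X_{1..5} := mgcd (tail (N v)) (tail (N w)).

Lemma vmonC v w : (vmon v w + lead (N v) = vmon w v + lead (N w))%MM.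
Proof.
rewrite /vmon ![lead _]/= !mon_lcm !mon_sub !mon_add; congr mon; lia.
Qed.

Ltac mon_arith :=
  rewrite /vmon /wmon ![lead _]/= ?[tail _]/= ?mon_lcm ?mon_sub ?mon_gcd ?mon_add;
  rewrite /height /=; congr mon; lia.

Section Mediant.
Variables v w x y : vec.
Hypothesis sv : strict_upper v.
Hypothesis sw : strict_lower w.
Hypothesis ex : x = addv v w.

(** Up to sign, the S-polynomial of v and x = v + w is a monomial times the
binomial of w: this is the syzygy of the edge from v to x. *)
Lemma upper_syzygy :
  (vmon v x + tail (N v) = wmon v x + lead (N w))%MM /\
  (vmon x v + tail (N x) = wmon v x + tail (N w))%MM.
Proof.
move: sv sw; rewrite ex /strict_upper /strict_lower /height /=.
by case: v w => [a b] [c e] /= h1 h2; split; mon_arith.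
Qed.

Lemma lower_syzygy :
  (vmon w x + tail (N w) = wmon w x + lead (N v))%MM /\
  (vmon x w + tail (N x) = wmon w x + tail (N v))%MM.
Proof.
move: sv sw; rewrite ex /strict_upper /strict_lower /height /=.
by case: v w => [a b] [c e] /= h1 h2; split; mon_arith.
Qed.

(** The coefficient at e_x of the edge from the upper source is a power of T0,
for the lower source it is a power of T1. *)
Lemma upper_quotient :
  vmon x v = mon (d1 * v.1 - u1 * height v - (d1 * x.1 - u1 * height x)) 0 0 0 0.
Proof.
move: sv sw; rewrite ex /strict_upper /strict_lower /height /=.
by case: v w => [a b] [c e] /= h1 h2; mon_arith.
Qed.

Lemma lower_quotient :
  vmon x w = mon 0 (d2 * w.2 - u2 * height w - (d2 * x.2 - u2 * height x)) 0 0 0.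
Proof.
move: sv sw; rewrite ex /strict_upper /strict_lower /height /=.
by case: v w => [a b] [c e] /= h1 h2; mon_arith.
Qed.

Lemma quotients_gt0 :
  (0 < d1 * v.1 - u1 * height v - (d1 * x.1 - u1 * height x))%N /\
  (0 < d2 * w.2 - u2 * height w - (d2 * x.2 - u2 * height x))%N.
Proof.
move: sv sw; rewrite ex /strict_upper /strict_lower /height /=.
by case: v w => [a b] [c e] /=; lia.
Qed.

(** Eliminating e_x from the two syzygies of the edges into x leaves the Koszul
syzygy of the binomials of v and w. *)
Lemma mediant_koszul :
  [/\ (vmon x w + vmon v x = lead (N w))%MM, (vmon x v + wmon w x = tail (N w))%MM,
      (vmon x w + wmon v x = tail (N v))%MM & (vmon x v + vmon w x = lead (N v))%MM].
Proof.
move: sv sw; rewrite ex /strict_upper /strict_lower /height /=.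
by case: v w => [a b] [c e] /= h1 h2; split; mon_arith.
Qed.

Lemma upper_triangle : strict_upper x -> y = addv x w ->
  [/\ (vmon v x + vmon w x = vmon y x + vmon w y)%MM,
      (vmon y w + wmon x y = wmon w x + wmon v x)%MM,
      (vmon v x + vmon x w = vmon y w + vmon x y)%MM
    & (vmon y x + wmon w y = wmon w x + vmon x v)%MM].
Proof.
move=> + ->; move: sv sw; rewrite ex /strict_upper /strict_lower /height /=.
by case: v w => [a b] [c e] /= h1 h2 h3; split; mon_arith.
Qed.

Lemma lower_triangle : strict_lower x -> y = addv v x ->
  [/\ (vmon w x + vmon v x = vmon y x + vmon v y)%MM,
      (vmon y v + wmon x y = wmon v x + wmon w x)%MM,
      (vmon w x + vmon x v = vmon y v + vmon x y)%MM
    & (vmon y x + wmon v y = wmon v x + vmon x w)%MM].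
Proof.
move=> + ->; move: sv sw; rewrite ex /strict_upper /strict_lower /height /=.
by case: v w => [a b] [c e] /= h1 h2 h3; split; mon_arith.
Qed.

End Mediant.
End Nodes.

(** * Free modules and polynomials *)

Lemma freemod_comb3E (R : comNzRingType) (J : finType) (a b d : R)
    (x y z : freemod R J) j :
  (a *: x - b *: y + d *: z) j = a * x j - b * y j + d * z j.
Proof. by rewrite !ffunE. Qed.

Lemma freemod_comb4E (R : comNzRingType) (J : finType) (a b d e : R)
    (x y z t : freemod R J) (j : J) (xj yj zj tj : R) :
  x j = xj -> y j = yj -> z j = zj -> t j = tj ->
  (a *: x - b *: y + d *: z - e *: t) j = a * xj - b * yj + d * zj - e * tj.
Proof. by move=> <- <- <- <-; rewrite !ffunE. Qed.

Lemma sum_single (M : zmodType) (I : finType) (i : I) (F : I -> M) :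
  (forall e, e != i -> F e = 0) -> \sum_e F e = F i.
Proof. by move=> F0; rewrite (bigD1 i) //= big1 ?addr0. Qed.

Lemma sum_pair (M : zmodType) (I : finType) (i j : I) (F : I -> M) :
  i != j -> (forall e, e != i -> e != j -> F e = 0) -> \sum_e F e = F i + F j.
Proof.
move=> ij F0; rewrite (bigD1 i) //= (bigD1 j) /=; last by rewrite eq_sym.
by rewrite big1 ?addr0 // => e /andP[ei ej]; apply: F0.
Qed.

Lemma mulN_pair (R : comNzRingType) (a b c c' e e' : R) :
  c = - c' -> e = - e' -> a * c + b * e = - (a * c' + b * e').
Proof. by move=> -> ->; rewrite !mulrN opprD. Qed.

Lemma pair_factor (R : comNzRingType) (x y c a b d e f h : R) :
  x = c * a -> y = - c * b -> d = e -> f = h ->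
  x * d + y * f = c * (a * e - b * h).
Proof. by move=> -> -> -> ->; ring. Qed.

(** The composite of the two maps at a triangle, in one coordinate: J, E, H, L
are the values of e_j, e_k, e_h, e_l there. *)
Lemma triangle_identity (R : comNzRingType)
    (vhk vjk vkj wjk vlk vjl vlj wjl vkl wkl vkh whk J H E L : R) :
  vhk * vjk = vlk * vjl -> vlj * wkl = wjk * whk ->
  vhk * vkj = vlj * vkl -> vlk * wjl = wjk * vkh ->
  vhk * (vjk * J - vkj * E + wjk * H) - vlk * (vjl * J - vlj * L + wjl * E)
  + vlj * (vkl * E - vlk * L + wkl * J) - wjk * (vhk * H - vkh * E + whk * J)
  = 0.
Proof.
move=> T1 T2 T3 T4.
transitivity ((vhk * vjk - vlk * vjl) * J + (vlj * wkl - wjk * whk) * J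
  - (vhk * vkj - vlj * vkl) * E - (vlk * wjl - wjk * vkh) * E); first by ring.
by rewrite T1 T2 T3 T4; ring.
Qed.

Lemma freemod_subZE (R : comNzRingType) (J : finType) (a : R)
    (x y : freemod R J) (j : J) (yj : R) :
  y j = yj -> (x - a *: y) j = x j - a * yj.
Proof. by move=> <-; rewrite !ffunE. Qed.

(** The combination of two edge syzygies that eliminates y, here the basis vector
of their common target, is a multiple of the single vector A x - B z up to the
terms D x and E z. *)
Lemma koszul_relation (R : comNzRingType) (J : finType)
    (a p q s p' s' A B C D E : R) (x y z : freemod R J) :
  a * p - q * s' = C * A - D -> q * p' - a * s = C * B - E ->
  q *: (p' *: z - a *: y + s' *: x) - a *: (p *: x - q *: y + s *: z) =
  D *: x - C *: (A *: x - B *: z) + E *: (- z).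
Proof.
move=> h1 h2; apply/ffunP => j; rewrite !ffunE /GRing.scale /=.
transitivity ((q * p' - a * s) * z j - (a * p - q * s') * x j); first by ring.
by rewrite h1 h2; ring.
Qed.

Section LinExt.
Variables (R : comNzRingType) (J : finType) (M : lmodType R).
Variable c : J -> M.

Definition lin_ext (x : freemod R J) : M := \sum_j x j *: c j.

Lemma lin_ext_is_linear : linear lin_ext.
Proof.
move=> a x y; rewrite /lin_ext scaler_sumr -big_split /=.
by apply: eq_bigr => j _; rewrite !ffunE scalerDl scalerA.
Qed.

HB.instance Definition _ :=
  GRing.isLinear.Build R (freemod R J) M *:%R lin_ext lin_ext_is_linear.

Lemma lin_extD x y : lin_ext (x + y) = lin_ext x + lin_ext y.
Proof. exact: (linearD lin_ext). Qed.

Lemma lin_extN x : lin_ext (- x) = - lin_ext x.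
Proof. exact: (linearN lin_ext). Qed.

Lemma lin_extZ a x : lin_ext (a *: x) = a *: lin_ext x.
Proof.
rewrite /lin_ext scaler_sumr.
by apply: eq_bigr => j _; rewrite !ffunE scalerA.
Qed.

Lemma lin_ext_addZ a x y : lin_ext (x + a *: y) = lin_ext x + a *: lin_ext y.
Proof. by rewrite lin_extD lin_extZ. Qed.

Lemma lin_ext_subZ a x y : lin_ext (x - a *: y) = lin_ext x - a *: lin_ext y.
Proof. by rewrite lin_extD lin_extN lin_extZ. Qed.

Lemma lin_ext_comb2 a b x y :
  lin_ext (a *: x - b *: y) = a *: lin_ext x - b *: lin_ext y.
Proof. by rewrite lin_extD lin_extN !lin_extZ. Qed.

Lemma lin_ext_comb3 a b d x y z :
  lin_ext (a *: x - b *: y + d *: z) =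
  a *: lin_ext x - b *: lin_ext y + d *: lin_ext z.
Proof. by rewrite !lin_extD lin_extN !lin_extZ. Qed.

Lemma lin_ext_comb4 a b d e x y z t :
  lin_ext (a *: x - b *: y + d *: z - e *: t) =
  a *: lin_ext x - b *: lin_ext y + d *: lin_ext z - e *: lin_ext t.
Proof. by rewrite lin_extD lin_extN lin_extZ lin_ext_comb3. Qed.

Lemma lin_ext_basis j : lin_ext (basis_vec R j) = c j.
Proof.
rewrite /lin_ext (bigD1 j) //= big1 => [|i ij].
  by rewrite ffunE eqxx scale1r addr0.
by rewrite ffunE (negPf ij) scale0r.
Qed.

End LinExt.

Lemma freemod_sum (R : comNzRingType) (J : finType) (x : freemod R J) :
  x = \sum_j x j *: basis_vec R j.
Proof.
apply/ffunP => i; rewrite sum_ffunE (bigD1 i) //= big1 => [|j ji].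
  by rewrite !ffunE eqxx addr0 [_ *: _]mulr1.
by rewrite !ffunE eq_sym (negPf ji) [_ *: _]mulr0.
Qed.

Section Monomials.
Variables (n : nat) (K : fieldType).
Local Notation S := {mpoly K[n]}.
Implicit Types (p q : S) (m k : 'X_{1..n}).

Lemma mcoeff_mulX p m k :
  (p * 'X_[m])@_k = if (m <= k)%MM then p@_(k - m) else 0.
Proof.
case: ifP => [h|/negbT h]; first by rewrite -{1}(submK h) addmC mcoeffMX.
apply/eqP; rewrite mcoeff_eq0; apply: contra h.
rewrite (perm_mem (msuppMX _ _)) => /mapP[k' _ ->].
exact: lem_addr.
Qed.

Lemma mulX_inj p m : p * 'X_[m] = 0 -> p = 0.
Proof.
move=> e; apply/mpolyP => k; rewrite mcoeff0.
by rewrite -(mcoeffMX p m k) e mcoeff0.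
Qed.

Lemma mulX_quotient p m :
  (forall k, p@_k != 0 -> (m <= k)%MM) -> exists c, p = c * 'X_[m].
Proof.
move=> h; exists (\sum_(k <- msupp p) p@_k *: 'X_[k - m]).
rewrite mulr_suml {1}(mpolyE p) !big_seq; apply: eq_bigr => k.
by rewrite mcoeff_msupp => /h mk; rewrite -scalerAl -mpolyXD submK.
Qed.

Lemma koszul_monomials p q m k : (forall i, m i = 0%N \/ k i = 0%N) ->
  p * 'X_[m] + q * 'X_[k] = 0 ->
  exists c, p = c * 'X_[k] /\ q = - c * 'X_[m].
Proof.
move=> dis /eqP; rewrite addr_eq0 => /eqP e.
have [c ec] : exists c, p = c * 'X_[k].
  apply: mulX_quotient => l; rewrite -(mcoeffMX p m l) e mcoeffN oppr_eq0 mcoeff_mulX.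
  case: ifP; rewrite ?eqxx // => /mnm_lepP h _; apply/mnm_lepP => i.
  by have := h i; rewrite mnmDE; case: (dis i) => ->.
exists c; split=> //; apply/eqP; rewrite -subr_eq0; apply/eqP.
apply: (@mulX_inj _ k); rewrite mulNr opprK mulrDl mulrAC.
by rewrite -ec e subrr.
Qed.

(** Going up the key, the coefficient of the smallest monomial m + leadm i can only
come from the leading term of i. *)
Lemma lead_independent (I : finType) (leadm tailm : I -> 'X_{1..n})
    (key : 'X_{1..n} -> nat) (c : I -> S) :
  {morph key : m k / (m + k)%MM >-> (m + k)%N} ->
  (forall i, key (leadm i) < key (tailm i))%N ->
  (forall i j m k, (c i)@_m != 0 -> (c j)@_k != 0 ->
     (m + leadm i)%MM = (k + leadm j)%MM -> i = j) ->
  \sum_i c i * ('X_[leadm i] - 'X_[tailm i]) = 0 -> forall i, c i = 0.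
Proof.
move=> keyD key_lt dis e i; apply/mpolyP => m; rewrite mcoeff0.
have [N] := ubnP (key (m + leadm i)%MM); elim: N i m => // N IH i m; rewrite ltnS => hN.
apply/eqP/negPn/negP => cm.
move/(congr1 (mcoeff (m + leadm i)%MM)): e; rewrite mcoeff0 raddf_sum /=.
rewrite (bigD1 i) //= big1 => [|j ji].
  have ci : (c i * 'X_[leadm i])@_(m + leadm i) = (c i)@_m by rewrite addmC mcoeffMX.
  rewrite addr0 mulrBr mcoeffB ci mcoeff_mulX; case: ifP => h.
    rewrite [X in _ - X](IH i) ?subr0; first by move/eqP; rewrite (negPf cm).
    apply: (leq_trans _ hN); rewrite -{2}(submK h) !keyD.
    by rewrite ltn_add2l key_lt.
  by rewrite subr0 => /eqP; rewrite (negPf cm).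
rewrite mulrBr mcoeffB !mcoeff_mulX.
have -> : (if (leadm j <= m + leadm i)%MM then
            (c j)@_(m + leadm i - leadm j) else 0) = 0.
  case: ifP => // h; apply/eqP/negPn/negP => cj; case/eqP: ji.
  by apply: (dis j i _ _ cj cm); rewrite submK.
case: ifP => h; last by rewrite subr0.
rewrite sub0r (IH j) ?oppr0 //.
apply: (leq_trans _ hN); rewrite -{2}(submK h) !keyD.
by rewrite ltn_add2l key_lt.
Qed.

Section NormalForms.
Variables (I : finType) (M : lmodType S) (eps : I -> M).
Variables (InN : M -> Prop) (reducible : I -> 'X_{1..n} -> bool).
Hypothesis N0 : InN 0.
Hypothesis ND : forall x y, InN x -> InN y -> InN (x + y).
Hypothesis NZ : forall (a : S) x, InN x -> InN (a *: x).

Definition normalizable (x : M) : Prop :=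
  exists c : I -> S, (forall i m, reducible i m -> (c i)@_m = 0) /\
    InN (x - \sum_i c i *: eps i).

Lemma normalizableD x y :
  normalizable x -> normalizable y -> normalizable (x + y).
Proof.
move=> [c [hc cx]] [c' [hc' cy]]; exists (fun i => c i + c' i); split.
  by move=> i m h; rewrite mcoeffD hc // hc' // addr0.
under eq_bigr do rewrite scalerDl.
by rewrite big_split opprD addrACA; apply: ND.
Qed.

Lemma normalizableZ (a : K) x : normalizable x -> normalizable (a%:MP *: x).
Proof.
move=> [c [hc cx]]; exists (fun i => a%:MP * c i); split.
  by move=> i m h; rewrite mcoeffCM hc // mulr0.
under eq_bigr do rewrite -scalerA.
by rewrite -scaler_sumr -scalerBr; apply: NZ.
Qed.

Lemma normalizableN x : normalizable x -> normalizable (- x).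
Proof.
move/(normalizableZ (-1)); rewrite mpolyCN mpolyC1.
by rewrite scaleN1r.
Qed.

Lemma normalizable_mod x : InN x -> normalizable x.
Proof.
move=> hx; exists (fun=> 0); split=> [i m _|]; first by rewrite mcoeff0.
by rewrite big1 ?subr0 // => i _; rewrite scale0r.
Qed.

Lemma normalizable_irreducible i m : ~~ reducible i m -> normalizable ('X_[m] *: eps i).
Proof.
move=> hm; exists (fun j => if j == i then 'X_[m] else 0); split.
  move=> j k; case: eqP => [->|_] h; last by rewrite mcoeff0.
  by rewrite mcoeffX; case: eqP => // e; rewrite e h in hm.
rewrite (bigD1 i) //= eqxx big1 => [|j /negPf ->]; last by rewrite scale0r.
by rewrite addr0 subrr.
Qed.

Lemma normalizable_span (J : finType) (e : J -> M) :
  (forall j m, normalizable ('X_[m] *: e j)) ->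
  forall y : J -> S, normalizable (\sum_j y j *: e j).
Proof.
move=> he y; apply: (big_ind normalizable) => [|x z|j _].
- exact: normalizable_mod.
- exact: normalizableD.
rewrite (mpolyE (y j)) scaler_suml.
apply: (big_ind normalizable) => [|x z|m _].
- exact: normalizable_mod.
- exact: normalizableD.
by rewrite -mul_mpolyC -scalerA; apply: normalizableZ.
Qed.

Lemma normalizable_cong x y : InN (x - y) -> normalizable y -> normalizable x.
Proof.
move=> h /normalizableD/(_ (normalizable_mod h)).
by rewrite addrC subrK.
Qed.

(** One reduction by a syzygy whose middle term is leading. *)
Lemma normalizable_step (m1 m2 mw k : 'X_{1..n}) (x y z : M) :
  InN ('X_[m1] *: x - 'X_[m2] *: y + 'X_[mw] *: z) ->
  normalizable ('X_[k + m1] *: x) -> normalizable ('X_[k + mw] *: z) ->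
  normalizable ('X_[k + m2] *: y).
Proof.
move=> /(NZ 'X_[k]) h hx hz; apply: normalizable_cong (normalizableD hx hz).
rewrite scalerDr scalerBr !scalerA -!mpolyXD in h.
by rewrite -opprB -scaleN1r; apply: NZ; rewrite addrAC.
Qed.

(** The normal form of a kernel element is in the kernel too, hence vanishes by
lead_independent, and only a member of InN is left. *)
Lemma normal_form_kernel (f : {linear M -> S^o})
    (leadm tailm : I -> 'X_{1..n}) (key : 'X_{1..n} -> nat) :
  {morph key : m k / (m + k)%MM >-> (m + k)%N} ->
  (forall i, key (leadm i) < key (tailm i))%N ->
  (forall i j m k, ~~ reducible i m -> ~~ reducible j k ->
     (m + leadm i)%MM = (k + leadm j)%MM -> i = j) ->
  (forall i, f (eps i) = 'X_[leadm i] - 'X_[tailm i]) ->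
  (forall x, InN x -> f x = 0) ->
  forall x, normalizable x -> f x = 0 -> InN x.
Proof.
move=> keyD key_lt dis fe fN x [c [hc cx]] fx.
have c0 : forall i, c i = 0.
  apply: (lead_independent keyD key_lt).
    move=> i j m k cm ck; apply: dis.
      by apply: contraNN cm => /hc ->.
    by apply: contraNN ck => /hc ->.
  transitivity (\sum_i (f (c i *: eps i) : S)).
    by apply: eq_bigr => i _; rewrite linearZ /= fe.
  apply/eqP; rewrite -oppr_eq0; apply/eqP.
  by have := fN _ cx; rewrite linearB fx sub0r linear_sum.
suff -> : x = x - \sum_i c i *: eps i by [].
by rewrite big1 ?subr0 // => i _; rewrite c0 scale0r.
Qed.

End NormalForms.

Lemma irrelevantD p q : irrelevant_ideal p -> irrelevant_ideal q ->
  irrelevant_ideal (p + q).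
Proof.
move=> [c ->] [c' ->]; exists (fun i => c i + c' i).
by rewrite -big_split; apply: eq_bigr => i _; rewrite mulrDl.
Qed.

Lemma irrelevantM p q : irrelevant_ideal p -> irrelevant_ideal (p * q).
Proof.
move=> [c ->]; exists (fun i => c i * q).
by rewrite mulr_suml; apply: eq_bigr => i _; rewrite mulrAC.
Qed.

Lemma irrelevantN p : irrelevant_ideal p -> irrelevant_ideal (- p).
Proof. by move/(irrelevantM (-1)); rewrite mulrN1. Qed.

Lemma irrelevantX m i : (0 < m i)%N -> irrelevant_ideal ('X_[m] : S).
Proof.
move=> mi; exists (fun j => if j == i then 'X_[m - U_(i)] else 0).
rewrite (bigD1 i) //= eqxx big1 => [|j /negPf ->]; last by rewrite mul0r.
rewrite addr0 -mpolyXD submK //; apply/mnm_lepP => j.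
by rewrite mnm1E; case: eqP => // <-.
Qed.

End Monomials.

(** * The maps of the resolution form a complex *)

(* Comparing two different polynomials must not unfold their arithmetic. *)
#[local] Opaque mpoly_add mpoly_opp mpoly_mul mpoly_scale mpolyC mpolyX.

Section Resolution.
Variable K : fieldType.
Variables d1 d2 u1 u2 : nat.
Hypothesis hu1 : (0 < u1 < d1)%N.
Hypothesis hu2 : (0 < u2 < d2)%N.
Variable vs : seq vec.
Local Notation V := (nth (0, 0)%N vs).
Hypothesis cV : mediant_chain d1 d2 u1 u2 V (size vs).
Local Notation N := (node d1 d2 u1 u2).
Local Notation g := (map N vs).
Local Notation r := (size g).
Local Notation row k := (upper d1 u1 (V k)).
Local Notation S := {mpoly K[5]}.
Local Notation src := (src cV).
Local Notation node_ord := (node_ord cV).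
Local Notation vmon := (vmon d1 d2 u1 u2).
Local Notation wmon := (wmon d1 d2 u1 u2).
Local Notation deg := (rees_deg d1 d2 u1 u2).
Implicit Types j k l h : 'I_r.

Lemma gen_node j : tnth (in_tuple g) j = N (V j).
Proof.
rewrite (tnth_nth (N (0, 0)%N)) /= (nth_map (0, 0)%N) //.
by rewrite -(size_g d1 d2 u1 u2 vs) ltn_ord.
Qed.

Lemma gE j : g_ j = 'X_[lead (N (V j))] - 'X_[tail (N (V j))] :> S.
Proof. by rewrite /g_ gen_node. Qed.

Lemma vE j k : v_ j k = 'X_[vmon (V j) (V k)] :> S.
Proof. by rewrite /v_ !gen_node. Qed.

Lemma wE j k : w_ j k = 'X_[wmon (V j) (V k)] :> S.
Proof. by rewrite /w_ !gen_node. Qed.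

Definition other_src j k : 'I_r := src (j != src true k) k.

Lemma other_srcE b k : (2 <= k)%N -> other_src (src b k) k = src (~~ b) k.
Proof. by move=> k2; rewrite /other_src src_neq //; case: b. Qed.

Lemma other_source_src j k h : edge j k -> other_source j k h -> h = other_src j k.
Proof.
case/(edgeP hu1 hu2 cV) => k2 [b ->].
by rewrite (other_sourceP hu1 hu2) // other_srcE // => /eqP.
Qed.

Definition col1 (e : 'I_r * 'I_r) : freemod S 'I_r :=
  let: (j, k) := e in
  v_ j k *: e_ j - v_ k j *: e_ k + w_ j k *: e_ (other_src j k).

Definition col2 (t : 'I_r * 'I_r * 'I_r) : freemod S (edge_type g) :=
  let: (j, k, l) := t in let h := other_src j k in
  v_ h k *: f_ j k - v_ l k *: f_ j l + v_ l j *: f_ k l - w_ j k *: f_ h k.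

Lemma col1_def j k :
  col1 (j, k) = v_ j k *: e_ j - v_ k j *: e_ k + w_ j k *: e_ (other_src j k).
Proof. by []. Qed.

Lemma col2_def j k l : col2 (j, k, l) =
  v_ (other_src j k) k *: f_ j k - v_ l k *: f_ j l + v_ l j *: f_ k l
  - w_ j k *: f_ (other_src j k) k.
Proof. by []. Qed.

Lemma col1E j k y : col1 (j, k) y =
  v_ j k * (y == j)%:R - v_ k j * (y == k)%:R + w_ j k * (y == other_src j k)%:R.
Proof. by rewrite [LHS]freemod_comb3E !ffunE. Qed.

Lemma col2E j k l (e : edge_type g) : col2 (j, k, l) e =
  v_ (other_src j k) k * (val e == (j, k))%:R - v_ l k * (val e == (j, l))%:R
  + v_ l j * (val e == (k, l))%:R - w_ j k * (val e == (other_src j k, k))%:R.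
Proof. by apply: freemod_comb4E; rewrite ffunE. Qed.

Definition phi0 : freemod S 'I_r -> S^o := lin_ext (fun j => g_ j : S^o).
Definition phi1 : freemod S (edge_type g) -> freemod S 'I_r :=
  lin_ext (fun e => col1 (val e)).
Definition phi2 : freemod S (triangle_type g) -> freemod S (edge_type g) :=
  lin_ext (fun t => col2 (val t)).

HB.instance Definition _ := GRing.Linear.on phi0.
HB.instance Definition _ := GRing.Linear.on phi1.
HB.instance Definition _ := GRing.Linear.on phi2.

#[local] Opaque col1 col2 v_ w_ g_.

Lemma phi0Z (a : S) x : phi0 (a *: x) = a * phi0 x.
Proof. exact: lin_extZ. Qed.

Lemma phi1Z (a : S) x : phi1 (a *: x) = a *: phi1 x.
Proof. exact: lin_extZ. Qed.

Lemma phi0_e j : phi0 (e_ j) = g_ j.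
Proof. exact: lin_ext_basis. Qed.

Lemma f_basis j k (jk : edge j k) :
  f_ j k = basis_vec S (exist (fun e => edge e.1 e.2) (j, k) jk : edge_type g).
Proof. by apply/ffunP => e; rewrite !ffunE. Qed.

Lemma phi1_f j k : edge j k -> phi1 (f_ j k) = col1 (j, k).
Proof. by move=> jk; rewrite (f_basis jk) /phi1 lin_ext_basis. Qed.

Lemma t_basis j k l (jkl : triangle j k l) :
  t_ j k l = basis_vec S
    (exist (fun t => triangle t.1.1 t.1.2 t.2) (j, k, l) jkl : triangle_type g).
Proof. by apply/ffunP => e; rewrite !ffunE. Qed.

Lemma phi2_t j k l : triangle j k l -> phi2 (t_ j k l) = col2 (j, k, l).
Proof. by move=> jkl; rewrite (t_basis jkl) /phi2 lin_ext_basis. Qed.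

Lemma src_syzygy b k (j := src b k) (h := src (~~ b) k) : (2 <= k)%N ->
  (vmon (V j) (V k) + tail (N (V j)) = wmon (V j) (V k) + lead (N (V h)))%MM /\
  (vmon (V k) (V j) + tail (N (V k)) = wmon (V j) (V k) + tail (N (V h)))%MM.
Proof.
move=> k2; have [st sb] := src_strict hu1 hu2 cV k2.
have ek := src_mediant cV k2.
rewrite {}/j {}/h; case: b => /=; first exact: upper_syzygy.
exact: lower_syzygy.
Qed.

Lemma phi0_col1 j k : edge j k -> phi0 (col1 (j, k)) = 0.
Proof.
case/(edgeP hu1 hu2 cV) => k2 [b ->]; rewrite col1_def other_srcE //.
rewrite [LHS]lin_ext_comb3.
have [e1 e2] := src_syzygy b k2.
move: (src b k) (src (~~ b) k) e1 e2 => j' h e1 e2.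
suff E : v_ j' k * g_ j' - v_ k j' * g_ k + w_ j' k * g_ h = 0 :> S.
  by rewrite -3!phi0_e in E.
rewrite !gE !vE wE !mulrBr -!mpolyXD -e1 -e2 (vmonC _ _ _ _ (V k)).
by ring.
Qed.

Lemma phi0_phi1 x : phi0 (phi1 x) = 0.
Proof.
rewrite /phi1 /lin_ext linear_sum /= big1 // => -[[j k] jk] _.
by rewrite phi0Z /= phi0_col1 // mulr0.
Qed.

(** The four coincidences of monomials that make the composite of the maps
vanish at the triangle (j, k, l) with h the other source of k. *)
Lemma src_triangle k l (j := src (~~ row k) k) (h := src (row k) k) :
  (2 <= k)%N -> k.+1 = l :> nat ->
  [/\ (vmon (V h) (V k) + vmon (V j) (V k) = vmon (V l) (V k) + vmon (V j) (V l))%MM,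
      (vmon (V l) (V j) + wmon (V k) (V l) = wmon (V j) (V k) + wmon (V h) (V k))%MM,
      (vmon (V h) (V k) + vmon (V k) (V j) = vmon (V l) (V j) + vmon (V k) (V l))%MM
    & (vmon (V l) (V k) + wmon (V j) (V l) = wmon (V j) (V k) + vmon (V k) (V h))%MM].
Proof.
move=> k2 kl; have [st sb] := src_strict hu1 hu2 cV k2.
have ek := src_mediant cV k2.
have l2 : (2 <= l)%N by rewrite -kl ltnW.
have [sl tl] := src_strict hu1 hu2 cV l2; have el := src_mediant cV l2.
have [e1 e2] := src_pred cV k2 kl.
rewrite /j /h; case: (row k) e1 e2 => /= e1 e2; rewrite e1 e2 in sl tl el.
  exact: upper_triangle.
exact: lower_triangle.
Qed.

Lemma phi1_col2 j k l : triangle j k l -> phi1 (col2 (j, k, l)) = 0.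
Proof.
case/(triangleP hu1 hu2 cV) => k2 kl ->.
have [e1 e2] := src_pred cV k2 kl.
have l2 : (2 <= l)%N by rewrite -kl ltnW.
have jk : edge (src (~~ row k) k) k by apply: (edge_src hu1 hu2).
have hk : edge (src (row k) k) k by apply: (edge_src hu1 hu2).
have jl : edge (src (~~ row k) k) l by rewrite -e2; apply: (edge_src hu1 hu2).
have kl' : edge k l by rewrite -{1}e1; apply: (edge_src hu1 hu2).
have [T1 T2 T3 T4] := src_triangle k2 kl.
have o1 : other_src (src (~~ row k) k) k = src (row k) k by rewrite other_srcE // negbK.
have o2 : other_src (src (~~ row k) k) l = k by rewrite -e2 other_srcE // negbK e1.
have o3 : other_src k l = src (~~ row k) k by rewrite -{1}e1 other_srcE // e2.
have o4 : other_src (src (row k) k) k = src (~~ row k) k by rewrite other_srcE.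
rewrite col2_def o1; move: jk hk jl kl' T1 T2 T3 T4 o1 o2 o3 o4.
move: (src (~~ row k) k) (src (row k) k) => {}j h.
move=> jk hk jl kl' T1 T2 T3 T4 o1 o2 o3 o4.
rewrite [LHS]lin_ext_comb4 -/phi1 (phi1_f jk) (phi1_f hk) (phi1_f jl) (phi1_f kl').
apply/ffunP => y.
rewrite [RHS]ffunE; etransitivity.
  apply: freemod_comb4E; exact: col1E.
rewrite o1 o2 o3 o4.
rewrite !vE.
rewrite !wE.
move/(congr1 (fun m => 'X_[m] : S)): T1; move/(congr1 (fun m => 'X_[m] : S)): T2.
move/(congr1 (fun m => 'X_[m] : S)): T3; move/(congr1 (fun m => 'X_[m] : S)): T4.
by rewrite !mpolyXD => T4 T3 T2 T1; apply: triangle_identity.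
Qed.

Lemma phi1_phi2 x : phi1 (phi2 x) = 0.
Proof.
rewrite /phi2 /lin_ext linear_sum /= big1 // => -[[[j k] l] jkl] _.
by rewrite phi1Z /= phi1_col2 // scaler0.
Qed.


(** * Exactness in the middle and injectivity *)

Lemma phi1E x y : phi1 x y = \sum_e x e * col1 (val e) y.
Proof. by rewrite sum_ffunE; apply: eq_bigr => e _; rewrite ffunE. Qed.

Lemma phi2E x e : phi2 x e = \sum_t x t * col2 (val t) e.
Proof. by rewrite sum_ffunE; apply: eq_bigr => t _; rewrite ffunE. Qed.

Definition inedge b k (k2 : (2 <= k)%N) : edge_type g :=
  exist _ (src b k, k) (edge_src hu1 hu2 cV b k2).

Lemma inedgeP b k (k2 : (2 <= k)%N) (e : edge_type g) : (val e).2 = k ->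
  e = inedge b k2 \/ e = inedge (~~ b) k2.
Proof.
case: e => -[j k'] jk /= ek; subst k'.
have /(edgeP hu1 hu2 cV)[_ [b' ej]] : edge j k by [].
have [eb|nb] := eqVneq b' b; [left|right]; apply: val_inj => /=.
  by rewrite ej eb.
by rewrite ej; congr (src _ _, _); case: (b) (b') nb => [] [].
Qed.

Lemma inedge_neq b k (k2 : (2 <= k)%N) : inedge b k2 != inedge (~~ b) k2.
Proof.
apply/negP => /eqP/(congr1 (fun e => (val e).1)) /= /eqP.
by rewrite (src_neq hu1 hu2) //; case: (b).
Qed.

Lemma other_src_lt j k : edge j k -> (other_src j k < k)%N.
Proof.
by case/(edgeP hu1 hu2 cV) => k2 [b ->]; rewrite other_srcE // src_lt.
Qed.

Lemma edge_lt j k : edge j k -> (j < k)%N.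
Proof. by case/(edgeP hu1 hu2 cV) => k2 [b ->]; rewrite src_lt. Qed.

Lemma edge_ge2 j k : edge j k -> (2 <= k)%N.
Proof. by case/(edgeP hu1 hu2 cV). Qed.

Lemma ord_gtF j k : (j < k)%N -> (k == j) = false.
Proof. by move=> jk; rewrite -(inj_eq val_inj) /= gtn_eqF. Qed.

Lemma ltn_ordF j k : (j < k)%N -> (j == k) = false.
Proof. by move=> jk; rewrite -(inj_eq val_inj) /= ltn_eqF. Qed.

(** An edge with target below L has its two sources below L as well. *)
Lemma phi1_last (x : freemod S (edge_type g)) (L : 'I_r) b (L2 : (2 <= L)%N) :
  (forall e, x e != 0 -> ((val e).2 <= L)%N) ->
  phi1 x L = - (x (inedge b L2) * v_ L (src b L)
              + x (inedge (~~ b) L2) * v_ L (src (~~ b) L)).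
Proof.
move=> hx.
have col b' : col1 (val (inedge b' L2)) L = - v_ L (src b' L).
  have jk : edge (src b' L) L by apply: (edge_src hu1 hu2 cV).
  rewrite col1E eqxx (ord_gtF (edge_lt jk)) (ord_gtF (other_src_lt jk)).
  by rewrite !mulr0 mulr1 sub0r addr0.
rewrite phi1E (sum_pair (inedge_neq b L2)) => [|e n1 n2].
  exact: mulN_pair (col _) (col _).
have [->|/hx] := eqVneq (x e) 0; first by rewrite mul0r.
rewrite leq_eqVlt => /orP[/eqP eL|lL].
  have [|] := inedgeP b L2 (val_inj eL) => ee; first by rewrite ee eqxx in n1.
  by rewrite ee eqxx in n2.
case: e lL {n1 n2} => -[j k] jk /= kL.
have jL := ltn_trans (edge_lt jk) kL; have hL := ltn_trans (other_src_lt jk) kL.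
rewrite col1E (ord_gtF kL) (ord_gtF jL) (ord_gtF hL).
by rewrite !mulr0 subr0 addr0 mulr0.
Qed.

Lemma v_neq0 j k : v_ j k != 0 :> S.
Proof.
rewrite vE; apply/eqP => /(congr1 (mcoeff (vmon (V j) (V k)))) /eqP.
by rewrite mcoeffX eqxx mcoeff0 oner_eq0.
Qed.

(** The coefficients are powers of T0 and of T1, a regular sequence. *)
Lemma src_koszul b (L : 'I_r) p q : (2 <= L)%N ->
  p * v_ L (src b L) + q * v_ L (src (~~ b) L) = 0 :> S ->
  exists c : S, p = c * v_ L (src (~~ b) L) /\ q = - c * v_ L (src b L).
Proof.
move=> L2; have [st sb] := src_strict hu1 hu2 cV L2.
have eL := src_mediant cV L2.
rewrite !vE; apply: koszul_monomials => i.
case: b; rewrite /= (upper_quotient st sb eL) (lower_quotient st sb eL) !monE;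
  by case: i => [[|[|[|[|[|]]]]]] //= _; (by left) || right.
Qed.

Lemma strict_upper_height v : strict_upper d1 d2 u1 u2 v -> (0 < height v)%N.
Proof. by case/strict_upper_deg. Qed.

Lemma height_gt0 k : (0 < height (V k))%N.
Proof.
have [_ V0 V1 _] := chain_prefix cV.
have [k2|] := leqP 2 k; last by case: (nat_of_ord k) => [|[|]]; rewrite ?V0 ?V1.
have [st _] := src_strict hu1 hu2 cV k2; rewrite (src_mediant cV k2).
by have := strict_upper_height st; rewrite /height /addv /=; clear; lia.
Qed.

Lemma gen_neq0 k : g_ k != 0 :> S.
Proof.
rewrite gE; apply/eqP => /(congr1 (mcoeff (lead (N (V k))))).
rewrite mcoeffB !mcoeffX eqxx mcoeff0; case: eqP => [e|_]; last first.
  by move/eqP; rewrite subr0 oner_eq0.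
have := congr1 (fun m : 'X_{1..5} => m (Ordinal (isT : 3 < 5)%N)) e.
by rewrite !monE /= => e0; have := height_gt0 k; rewrite -e0.
Qed.

(** The coefficients of x combine the two edge syzygies as in mediant_koszul, which
eliminates e_L and leaves a Koszul syzygy; this is its upper coordinate. *)
Lemma phi1_initial (x : freemod S (edge_type g)) (L : 'I_r) (c : S) (L2 : (2 <= L)%N) :
  (forall e, x e != 0 -> (val e).2 = L) ->
  x (inedge true L2) = c * v_ L (src false L) ->
  x (inedge false L2) = - c * v_ L (src true L) ->
  phi1 x (src true L) = c * g_ (src false L).
Proof.
move=> hx c1 c2; rewrite phi1E (sum_pair (inedge_neq true L2)) => [|e n1 n2].
  have [st sb] := src_strict hu1 hu2 cV L2; have eL := src_mediant cV L2.
  have [k1 k2 _ _] := mediant_koszul st sb eL.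
  rewrite gE -k1 -k2 !mpolyXD -!vE -wE.
  have et : edge (src true L) L by apply: (edge_src hu1 hu2 cV).
  have tL : (src true L == L) = false.
    by rewrite -(inj_eq val_inj) /= ltn_eqF ?edge_lt.
  have tf : (src true L == src false L) = false by rewrite src_neq.
  apply: pair_factor c1 c2 _ _; rewrite col1E other_srcE // tL ?eqxx tf.
    by rewrite !mulr0 mulr1 subr0 addr0.
  by rewrite !mulr0 mulr1 subr0 add0r.
have [->|/hx eL] := eqVneq (x e) 0; first by rewrite mul0r.
by case: (inedgeP true L2 eL) => ee; [rewrite ee eqxx in n1 | rewrite ee eqxx in n2].
Qed.

(** Descent on the largest target L of an edge in the support of x.  Its two
coefficients form a Koszul syzygy; the triangle with apex L removes them if
L > 2, and for L = 2 they vanish because the generators are not zero. *)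
Lemma ker_phi1 (x : freemod S (edge_type g)) : phi1 x = 0 ->
  exists z, phi2 z = x.
Proof.
have [n] : exists n, forall e, x e != 0 -> ((val e).2 < n)%N.
  by exists r => e _; apply: ltn_ord.
elim: n x => [|n IH] x hn x0.
  exists 0; rewrite [LHS]raddf0; apply/ffunP => e; rewrite ffunE; apply/esym/eqP.
  by apply/negPn/negP => /hn.
have [nr|rn] := ltnP n r; last first.
  by apply: IH => // e _; apply: leq_trans (ltn_ord _) rn.
pose L := Ordinal nr.
have hL e : x e != 0 -> ((val e).2 <= L)%N by move=> /hn.
have [L2|n2] := leqP 2 L; last first.
  apply: IH => // e; have /edge_ge2 e2 := valP e.
  by move/hL => eL; rewrite ltnNge (leq_trans e2 eL) in n2.
have kos b : exists c : S, x (inedge b L2) = c * v_ L (src (~~ b) L) /\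
    x (inedge (~~ b) L2) = - c * v_ L (src b L).
  apply: (src_koszul L2); apply/eqP; rewrite -oppr_eq0; apply/eqP.
  by rewrite -(phi1_last b L2 hL) x0 ffunE.
have drop b (y : freemod S (edge_type g)) :
    (forall e, y e != 0 -> ((val e).2 <= L)%N) ->
    y (inedge b L2) = 0 -> y (inedge (~~ b) L2) = 0 ->
    forall e, y e != 0 -> ((val e).2 < n)%N.
  move=> hy y1 y2 e ye; have := hy e ye; rewrite leq_eqVlt => /orP[/eqP eL|//].
  have [|] := inedgeP b L2 (val_inj eL) => ee; rewrite ee in ye.
    by rewrite y1 eqxx in ye.
  by rewrite y2 eqxx in ye.
have [L3|L3] := eqVneq (L : nat) 2%N.
  apply: IH => //; have [c [c1 c2]] := kos true.
  suff c0 : c = 0.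
    by apply: (drop true) => //; rewrite ?c1 ?c2 c0 ?oppr0 mul0r.
  have hx e : x e != 0 -> (val e).2 = L.
    move=> xe; apply/val_inj/eqP; rewrite eqn_leq (hL _ xe).
    exact: (leq_trans (eq_leq L3) (edge_ge2 (valP e))).
  have := phi1_initial hx c1 c2; rewrite x0 ffunE => /esym/eqP.
  by rewrite mulf_eq0 (negPf (gen_neq0 _)) orbF => /eqP.
have L3' : (2 < L)%N by rewrite ltn_neqAle eq_sym L3.
have kr : (L.-1 < r)%N by rewrite (leq_ltn_trans (leq_pred _)).
pose k := Ordinal kr; have kL : k.+1 = L :> nat by rewrite /= prednK // ltnW.
have k2 : (2 <= k)%N by rewrite -ltnS kL.
have [e1 e2] := src_pred cV k2 kL.
have [c [c1 c2]] := kos (row k).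
set j := src (~~ row k) k in e2.
have jkL : triangle j k L by apply/(triangleP hu1 hu2 cV).
rewrite e1 in c2; rewrite e2 in c1.
have jk : (j < k)%N by rewrite src_lt.
have lkL : (k < L)%N by rewrite -kL.
have jL := ltn_trans jk lkL.
have hk : (other_src j k < k)%N by apply: other_src_lt; apply: (edge_src hu1 hu2 cV).
pose y := x - c *: col2 (j, k, L).
have yE e : y e = x e - c * (v_ (other_src j k) k * (val e == (j, k))%:R
    - v_ L k * (val e == (j, L))%:R + v_ L j * (val e == (k, L))%:R
    - w_ j k * (val e == (other_src j k, k))%:R).
  exact: freemod_subZE (col2E _ _ _ _).
have [z ez] : exists z, phi2 z = y.
  apply: IH.
    apply: (drop (row k)).
    - move=> e; apply: contraR; rewrite -ltnNge => Le; rewrite yE.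
      have [xe|/hL] := eqVneq (x e) 0; last by rewrite leqNgt Le.
      have ne (a b : 'I_r) : (b <= L)%N -> (val e == (a, b)) = false.
        by move=> bL; apply/eqP => ee; rewrite ee /= ltnNge bL in Le.
      rewrite xe (ne j k (ltnW lkL)) (ne _ k (ltnW lkL)).
      by rewrite (ne j L (leqnn _)) (ne k L (leqnn _)) !(mulr0, subr0, addr0).
    - have ve : val (inedge (row k) L2) = (k, L) by rewrite -[in RHS]e1.
      rewrite yE ve !xpair_eqE (ord_gtF lkL) (ord_gtF jk) !eqxx !andbF andbT.
      by rewrite c1 !mulr0 mulr1; ring.
    - have ve : val (inedge (~~ row k) L2) = (j, L) by rewrite -e2.
      rewrite yE ve !xpair_eqE (ord_gtF lkL) (ltn_ordF jk) !eqxx !andbF andbT.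
      by rewrite c2 !mulr0 mulr1; ring.
  transitivity (phi1 x - c *: phi1 (col2 (j, k, L))).
    exact: lin_ext_subZ.
  by rewrite x0 phi1_col2 // scaler0 subr0.
exists (z + c *: t_ j k L); transitivity (phi2 z + c *: phi2 (t_ j k L)).
  exact: lin_ext_addZ.
by rewrite phi2_t // ez subrK.
Qed.

Lemma triangle_apex j k j' k' l :
  triangle j k l -> triangle j' k' l -> (j, k) = (j', k').
Proof.
case/(triangleP hu1 hu2 cV) => _ kl ->; case/(triangleP hu1 hu2 cV) => _ kl' ->.
by have -> : k = k' by apply/val_inj/eq_add_S; rewrite [LHS]kl.
Qed.

Lemma triangle_lt j k l : triangle j k l ->
  [/\ (j < k)%N, (k < l)%N & (other_src j k < k)%N].
Proof.
case/and3P => jk jl kl.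
by split; [exact: edge_lt jk | exact: edge_lt kl | exact: other_src_lt jk].
Qed.

(** Descent from the largest apex L: the edge from the early node j of the
triangle to its apex L is in no other triangle with apex at most L. *)
Lemma phi2_eq0 (z : freemod S (triangle_type g)) : phi2 z = 0 -> z = 0.
Proof.
move=> z0; apply/ffunP => t; rewrite ffunE.
have [m] := ubnP (r - (val t).2); elim: m t => // m IH t; rewrite ltnS => hm.
have above (t' : triangle_type g) : ((val t).2 < (val t').2)%N -> z t' = 0.
  by move=> lt; apply: IH; apply: leq_trans hm; rewrite ltn_sub2l.
case: t hm above => -[[j k] L] jkL hm above.
have /and3P[_ jL _] : triangle j k L := jkL.
have [jk kL hk] := triangle_lt jkL.
pose e : edge_type g := exist (fun e => edge e.1 e.2) (j, L) jL.
have := phi2E z e; rewrite z0 ffunE (sum_single (i := exist _ (j, k, L) jkL)).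
  rewrite col2E /= !xpair_eqE (ord_gtF kL) (ltn_ordF jk) !eqxx !andbF andbT.
  rewrite !mulr0 mulr1 !(sub0r, subr0, addr0) mulrN => /esym/eqP.
  by rewrite oppr_eq0 mulf_eq0 (negPf (v_neq0 _ _)) orbF => /eqP.
move=> [[[j' k'] L'] jkL'] ne.
have [L'L|L'L|eL] := ltngtP L' L; last 1 first.
- have eL' : L' = L by apply: val_inj.
  subst L'; case/eqP: ne; apply: val_inj => /=.
  by have [-> ->] := triangle_apex jkL jkL'.
- have [jk' kL' hk'] := triangle_lt (jkL' : triangle j' k' L').
  have LK (a b c : 'I_r) : (b < L)%N -> ((a, L) == (c, b) :> 'I_r * 'I_r) = false.
    by move=> bL; rewrite xpair_eqE (ord_gtF bL) andbF.
  rewrite col2E /= !LK ?(ltn_trans kL' L'L) //.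
  by rewrite !mulr0 !(subr0, addr0) mulr0.
- by rewrite [X in X * _]above ?mul0r.
Qed.

Lemma phi2_inj : injective phi2.
Proof.
move=> z z' e; apply/eqP; rewrite -subr_eq0; apply/eqP; apply: phi2_eq0.
transitivity (phi2 z - phi2 z'); last by rewrite e subrr.
by rewrite /phi2 [LHS]lin_extD [X in _ + X]lin_extN.
Qed.

(** * Exactness at the generators *)

Definition node0 : 'I_r := node_ord 0.
Definition node1 : 'I_r := node_ord 1.

Lemma node0E : node0 = 0%N :> nat.
Proof. by rewrite val_node_ord // ltnW // ltnW // ge3_r. Qed.

Lemma node1E : node1 = 1%N :> nat.
Proof. by rewrite val_node_ord // ltnW // ge3_r. Qed.

Lemma V_node0 : V node0 = (1, 0)%N.
Proof. by rewrite node0E; have [_ -> _ _] := chain_prefix cV. Qed.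

Lemma V_node1 : V node1 = (0, 1)%N.
Proof. by rewrite node1E; have [_ _ -> _] := chain_prefix cV. Qed.

(** Its image under phi0 is T0^d1 X2 - T1^d2 X0, the member of the Groebner basis
that is not a minimal generator. *)
Definition extra_vec : freemod S 'I_r :=
  'X_[mon 0 (d2 - u2) 0 0 0] *: e_ node0 - 'X_[mon (d1 - u1) 0 0 0 0] *: e_ node1.

(** None is the index of the extra member of the Groebner basis. *)
Definition eps (i : option 'I_r) : freemod S 'I_r :=
  if i is Some l then e_ l else extra_vec.

Definition lead_mon (i : option 'I_r) : 'X_{1..5} :=
  if i is Some l then lead (N (V l)) else mon d1 0 0 0 1.

Definition tail_mon (i : option 'I_r) : 'X_{1..5} :=
  if i is Some l then tail (N (V l)) else mon 0 d2 1 0 0.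

(** The leading terms of the syzygies: the edges into l for l >= 2, the
S-polynomial of the first two generators for l = 1, and its S-polynomial with
either of them, a multiple of X1, for the extra vector. *)
Definition reducible (i : option 'I_r) (m : 'X_{1..5}) : bool :=
  if i is Some l then
    if (2 <= l)%N then
      (vmon (V l) (V (src true l)) <= m)%MM || (vmon (V l) (V (src false l)) <= m)%MM
    else (l == node1) && (d1 - u1 <= m iT0)%N
  else (0 < m iX1)%N.

Definition im_phi1 (x : freemod S 'I_r) : Prop := exists b, phi1 b = x.

Lemma im_phi1_0 : im_phi1 0.
Proof. by exists 0; apply: (linear0 phi1). Qed.

Lemma im_phi1_D x y : im_phi1 x -> im_phi1 y -> im_phi1 (x + y).
Proof. by move=> [b <-] [c <-]; exists (b + c); apply: lin_extD. Qed.

Lemma im_phi1_Z (a : S) x : im_phi1 x -> im_phi1 (a *: x).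
Proof. by move=> [b <-]; exists (a *: b); apply: lin_extZ. Qed.

Local Notation nrm := (normalizable eps im_phi1 reducible).

Lemma im_phi1_col1 j k : edge j k -> im_phi1 (col1 (j, k)).
Proof. by move=> jk; exists (f_ j k); apply: phi1_f. Qed.

(** By definition extra_vec is a relation between the first two basis vectors. *)
Lemma normalizable_node1_step (m : 'X_{1..5}) : nrm ('X_[m] *: extra_vec) ->
  nrm ('X_[m + mon (d1 - u1) 0 0 0 0] *: e_ node1).
Proof.
move=> h; apply: (normalizable_step im_phi1_D im_phi1_Z
  (m1 := mon 0 (d2 - u2) 0 0 0) (mw := 0%MM) (x := e_ node0) (z := - extra_vec)).
- rewrite mpolyX0 scale1r subrr; exact: im_phi1_0.
- apply: (normalizable_irreducible eps im_phi1_0 (i := Some node0)).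
  by rewrite /= node0E /= -(inj_eq val_inj) /= node0E node1E.
- rewrite addm0 scalerN; exact: (normalizableN im_phi1_Z).
Qed.


Lemma lead_node01 : lead (N (V node0)) = mon (d1 - u1) 0 0 1 0 /\
  lead (N (V node1)) = mon 0 (d2 - u2) 0 1 0.
Proof.
rewrite V_node0 V_node1 /node /height /= !muln1 !muln0 !sub0n.
by split; congr mon; lia.
Qed.

Lemma tail_node01 : tail (N (V node0)) = mon 0 u2 1 0 0 /\
  tail (N (V node1)) = mon u1 0 0 0 1.
Proof.
rewrite V_node0 V_node1 /node /height /= !muln1 !muln0 !subn0.
by split; congr mon; lia.
Qed.

(** X1 * extra_vec differs by the Koszul syzygy of the first two generators from a
combination of their basis vectors, and that syzygy comes from the two edges
into the third node. *)
Lemma normalizable_extra_step (m : 'X_{1..5}) :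
  nrm ('X_[m + mon u1 0 0 0 1] *: e_ node0) ->
  nrm ('X_[m + mon 0 u2 1 0 0] *: e_ node1) ->
  nrm ('X_[m + mon 0 0 0 1 0] *: extra_vec).
Proof.
move=> h0 h1; pose L := node_ord 2; have r3 : (2 < r)%N := ge3_r cV.
have L2 : (2 <= L)%N by rewrite val_node_ord.
have [_ V0 V1 _] := chain_prefix cV.
have eT : src true L = node0.
  apply: val_inj; rewrite /= val_src // val_node_ord // node0E /= V1 V0.
  by rewrite /upper /height /= muln1 muln0 /= muln1 (proj2 (andP hu1)).
have eF : src false L = node1.
  apply: val_inj; rewrite /= val_src // val_node_ord // node1E /= V1.
  by rewrite /upper /height /= muln1 muln0.
have [st sb] := src_strict hu1 hu2 cV L2; have eL := src_mediant cV L2.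
have [k1 k2 k3 k4] := mediant_koszul st sb eL.
have et : edge node0 L by rewrite -eT; apply: (edge_src hu1 hu2 cV).
have ef : edge node1 L by rewrite -eF; apply: (edge_src hu1 hu2 cV).
have ot : other_src node0 L = node1 by rewrite -eT other_srcE // eF.
have of_ : other_src node1 L = node0 by rewrite -eF other_srcE // eT.
rewrite eT eF in k1 k2 k3 k4 => {eT eF st sb eL}.
have [l0 l1] := lead_node01; have [t0 t1] := tail_node01.
have X1D a b c e : mon a b c 1 e = (mon 0 0 0 1 0 + mon a b c 0 e)%MM.
  by rewrite mon_add.
apply: (normalizable_step im_phi1_D im_phi1_Z (m1 := mon u1 0 0 0 1)
  (m2 := mon 0 0 0 1 0) (mw := mon 0 u2 1 0 0) (k := m)
  (x := e_ node0) (y := extra_vec) (z := - e_ node1)); last first.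
- by rewrite scalerN; exact: (normalizableN im_phi1_Z h1).
- exact: h0.
have im : im_phi1 (v_ L node0 *: col1 (node1, L) - v_ L node1 *: col1 (node0, L)).
  by apply: im_phi1_D; [|rewrite -scaleNr]; apply: im_phi1_Z; apply: im_phi1_col1.
move: im; rewrite !col1_def ot of_.
rewrite [X in im_phi1 X -> _](koszul_relation (A := 'X_[mon 0 (d2 - u2) 0 0 0])
  (B := 'X_[mon (d1 - u1) 0 0 0 0]) (C := 'X_[mon 0 0 0 1 0])
  (D := 'X_[mon u1 0 0 0 1]) (E := 'X_[mon 0 u2 1 0 0])).
- exact.
- rewrite !vE wE -!mpolyXD -X1D -l1 -t1 -k1 -k2.
  by congr (_ - _); congr 'X_[_].
- rewrite !vE wE -!mpolyXD -X1D -l0 -t0 -k3 -k4.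
  by congr (_ - _); congr 'X_[_].
Qed.

Lemma normalizable_node0 m : nrm ('X_[m] *: e_ node0).
Proof.
apply: (normalizable_irreducible eps im_phi1_0 (i := Some node0)).
by rewrite /= node0E /= -(inj_eq val_inj) /= node0E node1E.
Qed.

(** The two reductions call each other: the step at extra_vec lowers the degree
in X1, the step at node1 keeps it.  Hence the induction on that degree, with
extra_vec treated first. *)
Lemma normalizable_extra_node1 m :
  nrm ('X_[m] *: extra_vec) /\ nrm ('X_[m] *: e_ node1).
Proof.
have [n] := ubnP (m iX1); elim: n m => // n IH m; rewrite ltnS => hm.
have h0 (k : 'X_{1..5}) : (k iX1 <= n)%N -> nrm ('X_[k] *: extra_vec).
  move=> hk; have [k0|k1] := posnP (k iX1).
    by apply: (normalizable_irreducible eps im_phi1_0 (i := None)); rewrite /= k0.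
  have le_k : (mon 0 0 0 1 0 <= k)%MM.
    by rewrite mon_le !leq0n k1.
  rewrite -(submK le_k).
  apply: normalizable_extra_step; first exact: normalizable_node0.
  apply: (proj2 (IH _ _)); rewrite mnmDE mnmBE !monE /= addn0 subn1.
  by rewrite prednK.
split; first exact: h0.
have [m0|m1] := ltnP (m iT0) (d1 - u1).
  apply: (normalizable_irreducible eps im_phi1_0 (i := Some node1)).
  by rewrite /= node1E /= eqxx /= -ltnNge.
have le_m : (mon (d1 - u1) 0 0 0 0 <= m)%MM.
  by rewrite mon_le !leq0n m1.
rewrite -(submK le_m); apply: normalizable_node1_step; apply: h0.
by rewrite mnmBE monE /= subn0.
Qed.

(** A reduction along an edge only involves smaller nodes. *)
Lemma normalizable_e l m : nrm ('X_[m] *: e_ l).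
Proof.
have [n] := ubnP (val l); elim: n l m => // n IH l m; rewrite ltnS => hl.
have [hr|hr] := boolP (reducible (Some l) m); last first.
  exact: (normalizable_irreducible eps im_phi1_0 hr).
have [l2|l1] := leqP 2 l; last first.
  have [->|n0] := eqVneq l node0; first exact: normalizable_node0.
  have -> : l = node1.
    apply: val_inj; rewrite /= node1E; case: (l) l1 n0 => -[|[|]] //= hl0 _.
    by rewrite -(inj_eq val_inj) /= node0E.
  exact: (proj2 (normalizable_extra_node1 m)).
have [b lb] : exists b, (vmon (V l) (V (src b l)) <= m)%MM.
  by move: hr; rewrite /= l2 => /orP[]; [exists true|exists false].
rewrite -(submK lb); apply: (normalizable_step im_phi1_D im_phi1_Z
  (m1 := vmon (V (src b l)) (V l)) (mw := wmon (V (src b l)) (V l))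
  (x := e_ (src b l)) (y := e_ l) (z := e_ (src (~~ b) l))).
- have bl : edge (src b l) l by apply: (edge_src hu1 hu2 cV).
  have := im_phi1_col1 bl.
  by rewrite col1_def (other_srcE b l2) !vE wE; exact.
- by apply: IH; apply: leq_trans hl; rewrite src_lt.
- by apply: IH; apply: leq_trans hl; rewrite src_lt.
Qed.

(** If m is irreducible at l >= 2, then the exponent of T0 in m * lead is smaller
than in the lead of the upper source, and that of T1 smaller than in the lead of
the lower source, while an earlier generator has in T0 or T1 at least the
exponent of the source in its row. *)
Lemma lead_disjoint (l l' : 'I_r) (m k : 'X_{1..5}) : (l' < l)%N ->
  ~~ reducible (Some l) m -> (m + lead (N (V l)))%MM <> (k + lead (N (V l')))%MM.
Proof.
move=> ll hr e.
have e0 : (m iT0 + (d1 * (V l).1 - u1 * height (V l)) =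
           k iT0 + (d1 * (V l').1 - u1 * height (V l')))%N.
  by move/(congr1 (fun m : 'X_{1..5} => m iT0)): e; rewrite !mnmDE !monE.
have e1 : (m iT1 + (d2 * (V l).2 - u2 * height (V l)) =
           k iT1 + (d2 * (V l').2 - u2 * height (V l')))%N.
  by move/(congr1 (fun m : 'X_{1..5} => m iT1)): e; rewrite !mnmDE !monE.
have [l2|l1] := leqP 2 l.
  have hk : (2 <= l < size vs)%N by rewrite l2 -(size_g d1 d2 u1 u2 vs) ltn_ord.
  have := chain_earlier hu1 hu2 cV hk ll.
  rewrite -!(val_src cV) //.
  have [st sb] := src_strict hu1 hu2 cV l2; have el := src_mediant cV l2.
  move: hr; rewrite /reducible l2 (upper_quotient st sb el) (lower_quotient st sb el).
  rewrite !mon_le !leq0n !andbT negb_or -!ltnNge => /andP[m0 m1].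
  case: ifP => _ le.
    by move: e0 m0 le; clear; lia.
  by move: e1 m1 le; clear; lia.
have lz : l = node1.
  by apply: val_inj; rewrite /= node1E; case: (nat_of_ord l) l1 ll => [|[|]].
have lz' : l' = node0.
  apply: val_inj; rewrite /= node0E; case: (nat_of_ord l') ll => //= n.
  by rewrite lz node1E.
move: e0; rewrite lz lz' V_node0 V_node1 /height /= !muln1 muln0 sub0n addn0 => e0.
move: hr; rewrite /reducible lz node1E /= eqxx /= -ltnNge => hm.
by move: e0 hm; clear; lia.
Qed.

Lemma lead_mon_inj (i j : option 'I_r) (m k : 'X_{1..5}) :
  ~~ reducible i m -> ~~ reducible j k ->
  (m + lead_mon i)%MM = (k + lead_mon j)%MM -> i = j.
Proof.
have hN (l : 'I_r) (m' k' : 'X_{1..5}) : ~~ reducible None k' ->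
    (m' + lead (N (V l)))%MM <> (k' + mon d1 0 0 0 1)%MM.
  rewrite /reducible -eqn0Ngt => /eqP k0 /(congr1 (fun m : 'X_{1..5} => m iX1)).
  by rewrite !mnmDE !monE /= k0; have := height_gt0 l; clear; lia.
case: i j => [l|] [l'|] // hi hj e.
- congr Some; apply: val_inj; case: (ltngtP l' l) => // h.
    by case: (lead_disjoint h hi e).
  by case: (lead_disjoint h hj (esym e)).
- by case: (hN l m k hj e).
- by case: (hN l' k m hi (esym e)).
Qed.

(** The leads of the generators have key 0; the weight 2 of X0 is for the extra
binomial T0^d1 X2 - T1^d2 X0, whose two terms have the same degree in X0, X2. *)
Definition key (m : 'X_{1..5}) : nat := (m iX0 * 2 + m iX2)%N.

Lemma keyD : {morph key : m k / (m + k)%MM >-> (m + k)%N}.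
Proof. by move=> m k; rewrite /key !mnmDE; lia. Qed.

Lemma key_lt i : (key (lead_mon i) < key (tail_mon i))%N.
Proof.
case: i => [l|]; rewrite /key /= !monE //=.
by have := height_gt0 l; rewrite /height; clear; lia.
Qed.

Lemma phi0_eps i : phi0 (eps i) = 'X_[lead_mon i] - 'X_[tail_mon i].
Proof.
case: i => [l|]; first by rewrite -gE; exact: phi0_e.
have [l0 l1] := lead_node01; have [t0 t1] := tail_node01.
transitivity ('X_[mon 0 (d2 - u2) 0 0 0] * g_ node0
  - 'X_[mon (d1 - u1) 0 0 0 0] * g_ node1 : S).
  rewrite -!phi0_e; exact: lin_ext_comb2.
rewrite !gE l0 l1 t0 t1 !mulrBr -!mpolyXD !mon_add.
transitivity ('X_[mon (d1 - u1) (d2 - u2) 0 1 0] - 'X_[tail_mon None]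
  - ('X_[mon (d1 - u1) (d2 - u2) 0 1 0] - 'X_[lead_mon None]) : S); last by ring.
by congr (_ - _ - (_ - _)); congr 'X_[_]; congr mon; move: hu1 hu2; clear; lia.
Qed.

Lemma ker_phi0 x : phi0 x = 0 -> exists b, phi1 b = x.
Proof.
have nx : nrm x.
  rewrite (freemod_sum x).
  exact: (normalizable_span im_phi1_0 im_phi1_D im_phi1_Z normalizable_e).
apply: (normal_form_kernel keyD key_lt lead_mon_inj phi0_eps _ nx).
by move=> y [b <-]; apply: phi0_phi1.
Qed.

(** * The generators generate the Rees ideal *)

Lemma deg_nth (m : 'X_{1..5}) (i : 'I_3) : deg m i = nth 0%N
  [:: m iT0 + d1 * m iX0 + u1 * m iX1; m iT1 + u2 * m iX1 + d2 * m iX2;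
      m iX0 + m iX1 + m iX2]%N i.
Proof.
have E (j : 'I_5) : inord j = j by rewrite inord_val.
by rewrite /rees_deg (mnm_nth 0%N) /= (E iT0) (E iT1) (E iX0) (E iX1) (E iX2).
Qed.

Lemma deg_eq (m k : 'X_{1..5}) : deg m = deg k <->
  [/\ m iT0 + d1 * m iX0 + u1 * m iX1 = k iT0 + d1 * k iX0 + u1 * k iX1,
      m iT1 + u2 * m iX1 + d2 * m iX2 = k iT1 + u2 * k iX1 + d2 * k iX2
    & m iX0 + m iX1 + m iX2 = k iX0 + k iX1 + k iX2]%N.
Proof.
split=> [/mnmP e|[e0 e1 e2]].
  have h0 := e (Ordinal (isT : 0 < 3)%N); have h1 := e (Ordinal (isT : 1 < 3)%N).
  have h2 := e (Ordinal (isT : 2 < 3)%N).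
  by move: h0 h1 h2; rewrite !deg_nth.
by apply/mnmP => i; rewrite !deg_nth e0 e1 e2.
Qed.

Lemma degD (m k : 'X_{1..5}) : deg (m + k)%MM = (deg m + deg k)%MM.
Proof.
apply/mnmP => i; rewrite mnmDE !deg_nth !mnmDE.
by case: i => [[|[|[|]]]] //= _; clear; lia.
Qed.

Lemma deg_lead_tail i : deg (lead_mon i) = deg (tail_mon i).
Proof.
apply/deg_eq; case: i => [l|] /=; rewrite !monE /=; last by split; clear; lia.
by rewrite /height; split; clear; lia.
Qed.

(** The quotient of m by k is a lattice vector (p, q).  If p + q > 0 its positive
part divides m and is divisible by the lead of a covering vector; if p + q = 0
it is a multiple of (1, -1), the vector of the extra binomial. *)
Lemma lead_mon_le (m k : 'X_{1..5}) : deg m = deg k ->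
  (k iX1 < m iX1)%N || (m iX1 == k iX1) && (m iX0 < k iX0)%N ->
  exists i, (lead_mon i <= m)%MM.
Proof.
move=> /deg_eq[e0 e1 e2] mk.
have [lt|[eX le]] : (k iX1 < m iX1)%N \/ m iX1 = k iX1 /\ (m iX0 < k iX0)%N.
- by case/orP: mk => [|/andP[/eqP]]; [left|right].
- pose p : int := (k iX0)%:Z - (m iX0)%:Z; pose q : int := (k iX2)%:Z - (m iX2)%:Z.
  have hX : p + q = (m iX1)%:Z - (k iX1)%:Z.
    by rewrite /p /q; move: e2; clear; lia.
  have h0 : deg0 d1 u1 p q = (m iT0)%:Z - (k iT0)%:Z.
    by rewrite /deg0 hX /p; move: e0; clear; lia.
  have h1 : deg1 d2 u2 p q = (m iT1)%:Z - (k iT1)%:Z.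
    by rewrite /deg1 hX /q; move: e1; clear; lia.
  have [|i ir [c0 c1 c2]] := chain_covers hu1 hu2 cV (p := p) (q := q).
    by rewrite hX; move: lt; clear; lia.
  have irr : (i < r)%N by rewrite (size_g d1 d2 u1 u2 vs).
  exists (Some (Ordinal irr)); rewrite /=.
  move: c0 c1 c2; rewrite hX h0 h1 /deg0 /deg1 -!PoszD -/(height (V i)) => c0 c1 c2.
  by rewrite mon_le; move: c0 c1 c2; clear; lia.
exists None; rewrite mon_le !leq0n /=; rewrite eX in e0.
have : (d1 * (m iX0).+1 <= d1 * k iX0)%N by rewrite leq_mul2l le orbT.
by rewrite mulnS; move: e0 eX le e2; clear; lia.
Qed.

Definition im_phi0 (x : S) : Prop := exists c, phi0 c = x.

Lemma im_phi0_D x y : im_phi0 x -> im_phi0 y -> im_phi0 (x + y).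
Proof. by move=> [b <-] [c <-]; exists (b + c); apply: lin_extD. Qed.

Lemma im_phi0_M (a : S) x : im_phi0 x -> im_phi0 (a * x).
Proof. by move=> [b <-]; exists (a *: b); apply: lin_extZ. Qed.

Lemma im_phi0_reduce i (m : 'X_{1..5}) : (lead_mon i <= m)%MM ->
  exists k : 'X_{1..5},
    [/\ deg k = deg m, (key m < key k)%N & im_phi0 ('X_[m] - 'X_[k])].
Proof.
move=> le; exists (m - lead_mon i + tail_mon i)%MM.
rewrite -{2 3 5}(submK le) !degD deg_lead_tail !keyD ltn_add2l key_lt; split=> //.
rewrite !mpolyXD -mulrBr -phi0_eps; apply: im_phi0_M; by exists (eps i).
Qed.

Lemma key_le (m : 'X_{1..5}) : (key m <= (deg m (Ordinal (isT : 2 < 3)%N)) * 2)%N.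
Proof. by rewrite deg_nth /= /key; clear; lia. Qed.

(** Rewriting either monomial increases its key, which is bounded in the given
multidegree. *)
Lemma im_phi0_same_deg (m k : 'X_{1..5}) : deg m = deg k -> im_phi0 ('X_[m] - 'X_[k]).
Proof.
pose B := (deg m (Ordinal (isT : 2 < 3)%N)).
have [n] := ubnP (B * 4 - key m - key k); rewrite {}/B.
elim: n m k => // n IH m k hn e.
have red_left (m' k' : 'X_{1..5}) : deg m' = deg m -> deg k' = deg m ->
   (key m' + key k' = key m + key k)%N ->
   (exists i, (lead_mon i <= m')%MM) -> im_phi0 ('X_[m'] - 'X_[k']).
  move=> em ek hkey [i /im_phi0_reduce[l [el kl hl]]].
  have -> : 'X_[m'] - 'X_[k'] = ('X_[m'] - 'X_[l]) + ('X_[l] - 'X_[k']) :> S by ring.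
  apply: im_phi0_D => //; apply: IH; rewrite ?el ?em ?ek //.
  have kb := key_le l; have kb' := key_le k'; rewrite el em in kb; rewrite ek in kb'.
  by move: hn hkey kl kb kb'; clear; lia.
have kD (a b : 'X_{1..5}) : deg a = deg b -> a iX1 = b iX1 -> a iX0 = b iX0 -> a = b.
  move=> /deg_eq[e0 e1 e2] eX1 eX0.
  have eX2 : a iX2 = b iX2 by move: e2 eX1 eX0; clear; lia.
  rewrite eX1 eX0 in e0; rewrite eX1 eX2 in e1.
  apply/mnmP => i; have eT0 : a iT0 = b iT0 by move: e0; clear; lia.
  have eT1 : a iT1 = b iT1 by move: e1; clear; lia.
  by case: i => [[|[|[|[|[|]]]]] hi] //; rewrite (bool_irrelevance hi isT).
have swap : im_phi0 ('X_[k] - 'X_[m]) -> im_phi0 ('X_[m] - 'X_[k]).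
  by move=> /(im_phi0_M (-1)); rewrite mulN1r opprB.
case: (ltngtP (k iX1) (m iX1)) => h1.
- by apply: red_left => //; apply: (lead_mon_le e); rewrite h1.
- apply/swap/red_left; rewrite 1?addnC //.
  by apply: (lead_mon_le (esym e)); rewrite h1.
case: (ltngtP (m iX0) (k iX0)) => h0.
- by apply: red_left => //; apply: (lead_mon_le e); rewrite h1 eqxx h0 orbT.
- apply/swap/red_left; rewrite 1?addnC //.
  by apply: (lead_mon_le (esym e)); rewrite h1 eqxx h0 orbT.
rewrite (kD _ _ e (esym h1) h0) subrr.
by exists 0; apply: (linear0 phi0).
Qed.

Local Notation rmap := (rees_map d1 d2 u1 u2).

Definition rees_tuple : 5.-tuple {mpoly K[3]} :=
  [tuple 'X_(inord 0); 'X_(inord 1); 'X_(inord 0) ^+ d1 * 'X_(inord 2);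
         'X_(inord 0) ^+ u1 * 'X_(inord 1) ^+ u2 * 'X_(inord 2);
         'X_(inord 1) ^+ d2 * 'X_(inord 2)].

Lemma rmapE (p : S) : rmap p = p \mPo rees_tuple.
Proof. by []. Qed.

Lemma rmapX (m : 'X_{1..5}) : rmap ('X_[m] : S) = 'X_[deg m].
Proof.
rewrite rmapE comp_mpolyX !big_ord_recl big_ord0 mulr1.
rewrite !(tnth_nth 0) /=.
rewrite !mpolyXn -!mpolyXD !mpolyXn -!mpolyXD; congr 'X_[_].
apply/mnmP => i; rewrite deg_nth !(mnmDE, mulmnE) !mnm1E.
have E (j : 'I_3) : inord j = j by rewrite inord_val.
rewrite (E (Ordinal (isT : 0 < 3)%N)) (E (Ordinal (isT : 1 < 3)%N)).
rewrite (E (Ordinal (isT : 2 < 3)%N)).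
have o0 : ord0 = iT0 by apply: val_inj.
have o1 : lift ord0 ord0 = iT1 by apply: val_inj.
have o2 : lift ord0 (lift ord0 ord0) = iX0 by apply: val_inj.
have o3 : lift ord0 (lift ord0 (lift ord0 ord0)) = iX1 by apply: val_inj.
have o4 : lift ord0 (lift ord0 (lift ord0 (lift ord0 ord0))) = iX2 by apply: val_inj.
rewrite o4 o3 o2 o1 o0.
by case: i => [[|[|[|]]]] hi //; rewrite -!val_eqE /=; clear; lia.
Qed.

Lemma rmapM (p q : S) : rmap (p * q) = rmap p * rmap q.
Proof. by rewrite !rmapE rmorphM. Qed.

Lemma rmap_gen j : rmap (g_ j : S) = 0.
Proof.
rewrite gE rmapE raddfB /= -!rmapE !rmapX.
by have := deg_lead_tail (Some j); rewrite /= => ->; rewrite subrr.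
Qed.

Lemma im_phi0_rmap p : im_phi0 p -> rmap p = 0.
Proof.
move=> [x <-]; rewrite rmapE /phi0 /lin_ext raddf_sum big1 // => j _.
transitivity (rmap (x j * g_ j : S)); first by [].
by rewrite rmapM rmap_gen mulr0.
Qed.

(** In the image of p the terms of each multidegree cancel, so every monomial of
p has a partner of the same multidegree; subtracting a multiple of their
difference shortens p. *)
Lemma rmap_im_phi0 (p : S) : rmap p = 0 -> im_phi0 p.
Proof.
have [n] := ubnP (size (msupp p)); elim: n p => // n IH p; rewrite ltnS => hn p0.
have [->|pn0] := eqVneq p 0; first by exists 0; apply: (linear0 phi0).
case ep: (msupp p) => [|m s].
  by move/eqP: ep; rewrite msupp_eq0 (negPf pn0).
have mp : m \in msupp p by rewrite ep mem_head.
have us : uniq (m :: s) by rewrite -ep msupp_uniq.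
have rE : \sum_(k <- m :: s) p@_k *: 'X_[deg k] = 0 :> {mpoly K[3]}.
  rewrite -ep -[RHS]p0 rmapE [p in RHS]mpolyE raddf_sum /=.
  by apply: eq_bigr => k _; rewrite comp_mpolyZ -rmapX.
have [k ks ek] : exists2 k : 'X_{1..5}, k \in s & deg k = deg m.
  suff /hasP[k ks /eqP ek] : has (fun k : 'X_{1..5} => deg k == deg m) s by exists k.
  apply/negPn/negP => /hasPn nk.
  move/(congr1 (mcoeff (deg m))): rE; rewrite big_cons mcoeff0 mcoeffD mcoeffZ.
  rewrite mcoeffX eqxx mulr1 raddf_sum /= big_seq big1 ?addr0 => [|k ks].
    by apply/eqP; rewrite -mcoeff_msupp.
  by rewrite mcoeffZ mcoeffX (negPf (nk k ks)) mulr0.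
have km : (k == m) = false.
  by apply/eqP => e; move: us; rewrite /= -e ks.
pose p' := p - p@_m *: ('X_[m] - 'X_[k]).
have sub : {subset msupp p' <= s}.
  move=> l; rewrite mcoeff_msupp /p' mcoeffB mcoeffZ mcoeffB !mcoeffX.
  have [<-|ml] := eqVneq m l; first by rewrite km subr0 mulr1 subrr eqxx.
  have [<-|kl] := eqVneq k l; first by [].
  rewrite subrr mulr0 subr0 -mcoeff_msupp ep inE eq_sym (negPf ml).
  by [].
have h : im_phi0 p'.
  apply: IH.
    apply: leq_trans hn; rewrite ep /= ltnS.
    exact: (uniq_leq_size (msupp_uniq p') sub).
  rewrite rmapE raddfB /= -rmapE p0 comp_mpolyZ raddfB /= -!rmapE !rmapX.
  by rewrite ek subrr scaler0 subrr.
have -> : p = p' + p@_m *: ('X_[m] - 'X_[k]) by rewrite /p' subrK.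
apply: im_phi0_D => //; rewrite -mul_mpolyC; apply: im_phi0_M.
exact: im_phi0_same_deg.
Qed.

(** * Minimality and multigrading *)

(** The height grows along an edge, so X1 occurs in v_ j k; the quotients the
other way are proper powers of T0 or T1; and the gcd of the tails contains the
X-part of the tail of j. *)
Lemma edge_irrelevant j k : edge j k ->
  [/\ irrelevant_ideal (v_ j k : S), irrelevant_ideal (v_ k j : S)
    & irrelevant_ideal (w_ j k : S)].
Proof.
case/(edgeP hu1 hu2 cV) => k2 [b ->].
have [st sb] := src_strict hu1 hu2 cV k2; have ek := src_mediant cV k2.
have [q0 q1] := quotients_gt0 st sb ek.
have ht := height_gt0 (src true k); have hb := height_gt0 (src false k).
have le1 : ((V (src b k)).1 <= (V k).1)%N.
  by rewrite ek /addv /=; case: (b); clear; lia.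
have le2 : ((V (src b k)).2 <= (V k).2)%N.
  by rewrite ek /addv /=; case: (b); clear; lia.
have lth : (height (V (src b k)) < height (V k))%N.
  rewrite [in height (V k)]ek /height /=; rewrite /height in ht hb.
  by case: (b); move: ht hb; clear; lia.
have hj := height_gt0 (src b k).
split.
- rewrite vE; apply: (irrelevantX _ (i := iX1)).
  rewrite /vmon ![lead _]/= mon_lcm mon_sub monE /=.
  by move: lth; clear; lia.
- rewrite vE; case: (b).
    apply: (irrelevantX _ (i := iT0)); rewrite (upper_quotient st sb ek) monE.
    exact: q0.
  apply: (irrelevantX _ (i := iT1)); rewrite (lower_quotient st sb ek) monE.
  exact: q1.
rewrite wE /wmon ![tail _]/= mon_gcd; rewrite /height in hj.
have [p0|p0] := posnP (V (src b k)).1.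
  apply: (irrelevantX _ (i := iX2)); rewrite monE /=.
  by move: p0 hj le2; clear; lia.
apply: (irrelevantX _ (i := iX0)); rewrite monE /=.
by move: p0 le1; clear; lia.
Qed.

Lemma phi1_basis e : phi1 (basis_vec S e) = col1 (val e).
Proof. exact: lin_ext_basis. Qed.

Lemma phi2_basis t : phi2 (basis_vec S t) = col2 (val t).
Proof. exact: lin_ext_basis. Qed.

Lemma phi1_minimal : minimal_map phi1.
Proof.
move=> [[j k] jk] y; rewrite phi1_basis /= col1E.
have [i1 i2 i3] := edge_irrelevant jk.
apply: irrelevantD; last exact: irrelevantM.
by apply: irrelevantD; last apply: irrelevantN; apply: irrelevantM.
Qed.

Lemma triangle_edges j k l : triangle j k l -> [/\ edge j k, edge j l & edge k l].
Proof. by case/and3P. Qed.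

Lemma edge_other_src j k : edge j k -> edge (other_src j k) k.
Proof.
case/(edgeP hu1 hu2 cV) => k2 [b ->]; rewrite other_srcE //.
exact: (edge_src hu1 hu2 cV).
Qed.

Lemma phi2_minimal : minimal_map phi2.
Proof.
move=> [[[j k] l] jkl] e; rewrite phi2_basis /= col2E.
have [jk jl kl] := triangle_edges jkl.
have [_ _ w_jk] := edge_irrelevant jk.
have [v_hk _ _] := edge_irrelevant (edge_other_src jk).
have [_ v_lj _] := edge_irrelevant jl.
have [_ v_lk _] := edge_irrelevant kl.
apply: irrelevantD; last by apply/irrelevantN/irrelevantM.
apply: irrelevantD; last exact: irrelevantM.
by apply: irrelevantD; last apply: irrelevantN; apply: irrelevantM.
Qed.

(** The multidegrees of the basis vectors: those of the generators, of the lcm of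
the leads at the ends of an edge, and of the coefficient of f_ j l times f_ j l. *)
Definition degN j : 'X_{1..3} := deg (lead (N (V j))).

Definition degE (jk : 'I_r * 'I_r) : 'X_{1..3} :=
  deg (vmon (V jk.1) (V jk.2) + lead (N (V jk.1)))%MM.

Definition degT (jkl : 'I_r * 'I_r * 'I_r) : 'X_{1..3} :=
  let: (j, k, l) := jkl in
  deg (vmon (V l) (V k) + (vmon (V j) (V l) + lead (N (V j))))%MM.

Lemma msupp_comb (a b : S) (mu : 'X_{1..5}) : mu \in msupp (a + b) ->
  mu \in msupp a \/ mu \in msupp b.
Proof. by move/msuppD_le; rewrite mem_cat => /orP. Qed.

Lemma msupp_term (m mu : 'X_{1..5}) (b : bool) :
  mu \in msupp ('X_[m] * b%:R : S) -> b /\ mu = m.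
Proof.
case: b; last by rewrite mulr0 msupp0.
by rewrite mulr1 msuppX inE => /eqP.
Qed.

Lemma msupp_opp (a : S) (mu : 'X_{1..5}) : mu \in msupp (- a) -> mu \in msupp a.
Proof. by rewrite (perm_mem (msuppN a)). Qed.

Lemma phi0_homogeneous j : homogeneous deg (degN j) (phi0 (basis_vec S j)).
Proof.
move=> mu; rewrite [phi0 _]lin_ext_basis gE => /msupp_comb[|/msupp_opp];
  rewrite msuppX inE => /eqP -> //.
by rewrite /degN; have := deg_lead_tail (Some j); rewrite /= => ->.
Qed.

Lemma phi1_graded : graded_map deg (fun e => degE (val e)) degN phi1.
Proof.
move=> [[j k] jk] y mu; rewrite phi1_basis /= col1E !vE wE.
have [k2 [b ej]] := elimT (edgeP hu1 hu2 cV j k) jk.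
have ho : other_src j k = src (~~ b) k by rewrite ej other_srcE.
have [e1 _] := src_syzygy b k2; rewrite -ej -ho in e1.
case/msupp_comb => [/msupp_comb[|/msupp_opp]|] /msupp_term[/eqP -> ->];
  rewrite /degN /degE -degD //=.
  by rewrite (vmonC d1 d2 u1 u2 (V k) (V j)).
by rewrite -e1 !degD; have := deg_lead_tail (Some j); rewrite /= => ->.
Qed.

Lemma phi2_graded :
  graded_map deg (fun t => degT (val t)) (fun e => degE (val e)) phi2.
Proof.
move=> [[[j k] l] jkl] e mu; rewrite phi2_basis /= col2E !vE wE.
have [k2 kl ej] := elimT (triangleP hu1 hu2 cV j k l) jkl.
have [T1 T2 T3 T4] := src_triangle k2 kl; rewrite -ej in T1 T2 T3 T4.
have ho : other_src j k = src (row k) k by rewrite ej other_srcE // negbK.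
rewrite -ho in T1 T2 T3 T4.
have [e1 _] := src_syzygy (~~ row k) k2; rewrite -ej negbK -ho in e1.
have d1' := deg_lead_tail (Some j); rewrite /= in d1'.
case/msupp_comb => [/msupp_comb[/msupp_comb[|/msupp_opp]|]|/msupp_opp];
  move=> /msupp_term[/eqP -> ->]; rewrite /degE /degT -degD //=.
- by rewrite !addmA T1.
- by rewrite addmA -T3 -addmA (vmonC d1 d2 u1 u2 (V k) (V j)) !addmA T1.
- by rewrite addmA [X in deg (X + _)%MM]addmC -addmA -e1 addmA T1 degD -d1' -degD addmA.
Qed.

Lemma phi_minimal_free_resolution :
  minimal_free_resolution deg (rees_ideal d1 d2 u1 u2) phi0 phi1 phi2.
Proof.
split; last by split; [exact: phi1_minimal | exact: phi2_minimal].
- split=> [p|y|y|]; last exact: phi2_inj.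
  + by rewrite inE; split=> [/eqP/rmap_im_phi0 //|/im_phi0_rmap/eqP].
  + by split=> [/ker_phi0 //|[x <-]]; apply: phi0_phi1.
  + by split=> [/ker_phi1 //|[x <-]]; apply: phi1_phi2.
exists degN, (fun e => degE (val e)), (fun t => degT (val t)).
by split; [exact: phi0_homogeneous | exact: phi1_graded | exact: phi2_graded].
Qed.

Lemma phi1_edge j k h : edge j k -> other_source j k h ->
  phi1 (f_ j k) = v_ j k *: e_ j - v_ k j *: e_ k + w_ j k *: e_ h.
Proof.
by move=> jk /(other_source_src jk) ->; rewrite (phi1_f jk) col1_def.
Qed.

Lemma phi2_triangle j k l h : triangle j k l -> other_source j k h ->
  phi2 (t_ j k l) = v_ h k *: f_ j k - v_ l k *: f_ j l + v_ l j *: f_ k l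
                    - w_ j k *: f_ h k.
Proof.
move=> jkl; have [jk _ _] := triangle_edges jkl.
by move=> /(other_source_src jk) ->; rewrite (phi2_t jkl) col2_def.
Qed.

End Resolution.

Theorem theorem5p5 (K : fieldType) (d1 d2 u1 u2 : nat)
    (hu1 : (0 < u1 < d1)%N) (hu2 : (0 < u2 < d2)%N) :
  let S := {mpoly K[5]} in
  let g := rees_gens d1 d2 u1 u2 in
  let r := size g in
  [/\ (3 <= r)%N, #|{: edge_type g}| = (2 * (r - 2))%N,
      #|{: triangle_type g}| = (r - 3)%N
    & exists (phi0 : {linear freemod S 'I_r -> S^o})
             (phi1 : {linear freemod S (edge_type g) -> freemod S 'I_r})
             (phi2 : {linear freemod S (triangle_type g) ->
                             freemod S (edge_type g)}),
      [/\ forall j, phi0 (e_ j) = g_ j,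
          forall j k h : 'I_r, edge j k -> other_source j k h ->
            phi1 (f_ j k) =
              v_ j k *: e_ j - v_ k j *: e_ k + w_ j k *: e_ h,
          forall j k l h : 'I_r, triangle j k l -> other_source j k h ->
            phi2 (t_ j k l) =
              v_ h k *: f_ j k - v_ l k *: f_ j l
              + v_ l j *: f_ k l - w_ j k *: f_ h k
        & minimal_free_resolution (rees_deg d1 d2 u1 u2)
            (rees_ideal d1 d2 u1 u2) phi0 phi1 phi2]].
Proof.
move=> S; have [vs [cV ->]] := rees_gens_chain hu1 hu2.
move=> g r; split.
- exact: (ge3_r cV).
- exact: (card_edges hu1 hu2 cV).
- exact: (card_triangles hu1 hu2 cV).
exists (@phi0 K d1 d2 u1 u2 vs), (@phi1 K d1 d2 u1 u2 vs cV),
  (@phi2 K d1 d2 u1 u2 vs cV); split.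
- exact: phi0_e.
- by move=> j k h jk hjk; apply: (phi1_edge K hu1 hu2 cV jk hjk).
- by move=> j k l h jkl hjk; apply: (phi2_triangle K hu1 hu2 cV jkl hjk).
exact: (phi_minimal_free_resolution K hu1 hu2 cV).
Qed.
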